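(* Let $N\ge 1$ be an integer, let $p>1$, $T>0$, let $l>0$ be noninteger, and let $\Omega\subset\mathbb{R}^N$ be a domain (bounded or unbounded) with smooth boundary (of class $C^{l}$). Put $\Omega_T=\Omega\times(0,T)$ and $\overline{\Omega}_T=\overline{\Omega}\times[0,T]$. Then there is a constant $C>0$, depending only on the fixed data $N,\Omega,T,p,l$ and not on $u$, such that for every $u(x,t)\in C^{l,\frac{l}{2}}(\overline{\Omega}_T)\cap L_p(\Omega_T)$ the following hold. (i) One has $$|u|^{(0)}_{\overline{\Omega}_T}\le C\left(|u|^{(l)}_{\overline{\Omega}_T}\right)^{\omega}\left(\|u\|_{p,\Omega_T}\right)^{1-\omega},\qquad \omega=\frac{N+2}{lp+N+2}.$$ (ii) If, in addition, $\sup_{0<t<T}\|u(\cdot,t)\|_{p,\Omega}<\infty$, then $$|u|^{(0)}_{\overline{\Omega}_T}\le C\left(|u|^{(l)}_{\overline{\Omega}_T}\right)^{\sigma}\left(\sup_{0<t<T}\|u(\cdot,t)\|_{p,\Omega}\right)^{1-\sigma},\qquad \sigma=\frac{N}{lp+N}.$$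
   Context: $\|\cdot\|_{p,\Omega}$ and $\|\cdot\|_{p,\Omega_T}$ denote the norms of the Lebesgue spaces $L_p(\Omega)$ and $L_p(\Omega_T)$. Parabolic Hölder spaces. For an integer $m\ge 0$ put $$|u|^{(m)}_{\overline{\Omega}_T}=\sum_{|\overline{\beta}|+2j\le m}\ \max_{\overline{\Omega}_T}\left|D_t^jD_x^{\overline{\beta}}u(x,t)\right|,$$ where $\overline{\beta}=(\beta_1,\dots,\beta_N)$ is a multiindex with $|\overline\beta|=\beta_1+\dots+\beta_N$ and $j\ge 0$ is an integer; in particular $|u|^{(0)}_{\overline{\Omega}_T}=\max_{\overline{\Omega}_T}|u|$ (the maximum is understood as a supremum when $\Omega$ is unbounded). For $\gamma\in(0,1)$ let $$\langle w\rangle^{(\gamma)}_{x,\overline{\Omega}_T}=\sup\frac{|w(x,t)-w(y,t)|}{|x-y|^{\gamma}},\qquad \langle w\rangle^{(\gamma)}_{t,\overline{\Omega}_T}=\sup\frac{|w(x,t)-w(x,\tau)|}{|t-\tau|^{\gamma}},$$ the suprema being over distinct points of $\overline{\Omega}_T$ of the indicated form. For noninteger $l=m+\alpha$, with $m\ge 0$ an integer and $\alpha\in(0,1)$, the space $C^{l,\frac{l}{2}}(\overline{\Omega}_T)$ consists of the functions with finite norm $$|u|^{(l)}_{\overline{\Omega}_T}=|u|^{(m)}_{\overline{\Omega}_T}+\langle u\rangle^{(l)}_{x,\overline{\Omega}_T}+\langle u\rangle^{(l)}_{t,\overline{\Omega}_T},$$ where $$\langle u\rangle^{(m+\alpha)}_{x,\overline{\Omega}_T}=\sum_{0\le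 m-|\overline{\beta}|-2j\le 1}\left\langle D_t^jD_x^{\overline{\beta}}u\right\rangle^{(\alpha)}_{x,\overline{\Omega}_T},\qquad \langle u\rangle^{(m+\alpha)}_{t,\overline{\Omega}_T}=\sum_{0\le m-|\overline{\beta}|-2j\le 1}\left\langle D_t^jD_x^{\overline{\beta}}u\right\rangle^{\left(\frac{m-|\overline{\beta}|-2j+\alpha}{2}\right)}_{t,\overline{\Omega}_T}.$$
   Formalization: The smooth boundary is taken to be at least C^1 when l<1 (C^l cusps make the claim false), and if the boundary is unbounded its local C^l graph charts have a uniform radius and uniform bounds (domains thinning at infinity make the claim false). *)

(* Defs.v *)
From HB Require Import structures.
From mathcomp Require Import all_boot all_order all_algebra.
From mathcomp Require Import all_classical all_reals all_analysis.

Set Implicit Arguments.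
Unset Strict Implicit.
Unset Printing Implicit Defensive.

Import Order.TTheory GRing.Theory Num.Theory.
Import numFieldNormedType.Exports.

Local Open Scope classical_set_scope.
Local Open Scope ring_scope.

(* The sigma-algebra generated by the coordinates, i.e. the Borel
   sigma-algebra of R^n; same construction as the library's for n-tuples. *)
Definition rV_display : measure_display -> measure_display.
Proof. exact. Qed.

Section rV_measurable.
Context {R : realType} (n : nat).

Let coors (i : 'I_n) (v : 'rV[R]_n) : measurableTypeR R := v ord0 i.

Let rV_set0 : g_sigma_preimage coors set0.
Proof. exact: sigma_algebra0. Qed.

Let rV_setC A : g_sigma_preimage coors A -> g_sigma_preimage coors (~` A).
Proof. exact: sigma_algebraC. Qed.

Let rV_bigcup (F : _^nat) : (forall i, g_sigma_preimage coors (F i)) ->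
  g_sigma_preimage coors (\bigcup_i (F i)).
Proof. exact: sigma_algebra_bigcup. Qed.

HB.instance Definition _ := @isMeasurable.Build (rV_display default_measure_display)
  'rV[R]_n (g_sigma_preimage coors) rV_set0 rV_setC rV_bigcup.

End rV_measurable.

Section rV_lemmas.
Context {R : realType}.

Lemma measurable_coord_rV n (i : 'I_n) :
  measurable_fun [set: 'rV[R]_n]
    (fun v : 'rV[R]_n => v ord0 i : measurableTypeR R).
Proof.
move=> _ A mA; apply: sub_sigma_algebra.
rewrite -bigcup_seq; exists i; first by rewrite /= mem_index_enum.
by exists A.
Qed.

Lemma measurable_fun_rVP d (T : measurableType d) n (f : T -> 'rV[R]_n) :
  (forall i, measurable_fun [set: T]
     (fun x => f x ord0 i : measurableTypeR R)) ->
  measurable_fun [set: T] f.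
Proof.
move=> mf; apply: measurability => //.
move=> _ [B + <-].
rewrite -bigcup_seq => -[i _ [A mA <-]].
by have := mf i measurableT _ mA; rewrite !setTI.
Qed.

Definition rcons_rV n (z : 'rV[R]_n * measurableTypeR R) : 'rV[R]_n.+1 :=
  \row_i oapp (fun j => z.1 ord0 j) z.2 (unlift ord_max i).

Definition unrcons_rV n (v : 'rV[R]_n.+1) : 'rV[R]_n * measurableTypeR R :=
  (\row_j v ord0 (lift ord_max j), v ord0 ord_max).

Lemma rcons_rVK n : cancel (@rcons_rV n) (@unrcons_rV n).
Proof.
case=> v x; rewrite /unrcons_rV /rcons_rV/=; congr pair.
- by apply/rowP => j; rewrite !mxE liftK.
- by rewrite mxE unlift_none.
Qed.

Lemma measurable_rcons_rV n : measurable_fun setT (@rcons_rV n).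
Proof.
apply: measurable_fun_rVP => i.
case: (unliftP ord_max i) => [j|] ->.
- rewrite [X in measurable_fun _ X](_ : _ =
    (fun v : 'rV[R]_n => v ord0 j : measurableTypeR R) \o fst).
    exact: measurableT_comp (measurable_coord_rV j) _.
  by apply/funext => z /=; rewrite mxE liftK.
- rewrite [X in measurable_fun _ X](_ : _ = snd)//.
  by apply/funext => z /=; rewrite mxE unlift_none.
Qed.

Lemma measurable_unrcons_rV n : measurable_fun setT (@unrcons_rV n).
Proof.
apply/measurable_fun_pairP; split => /=; last exact: measurable_coord_rV.
apply: measurable_fun_rVP => i.
rewrite [X in measurable_fun _ X](_ : _ =
  (fun v : 'rV[R]_n.+1 => v ord0 (lift ord_max i) : measurableTypeR R)).
  exact: measurable_coord_rV.
by apply/funext => v /=; rewrite mxE.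
Qed.

End rV_lemmas.

(* Lebesgue measure on R^n: see lebesgue_rV_box for its value on boxes. *)
Fixpoint lebesgue_rV {R : realType} (n : nat) : set 'rV[R]_n -> \bar R :=
  match n with
  | 0 => dirac (0 : 'rV[R]_0)
  | n.+1 => pushforward (lebesgue_rV (n := n) \x lebesgue_measure)%E
              (@rcons_rV R n)
  end.

Section rcons_measure.
Context {R : realType} (n : nat).
Variable m1 : {sigma_finite_measure set 'rV[R]_n -> \bar R}.

Let m : {measure set ('rV[R]_n * measurableTypeR R)%type -> \bar R} :=
  (m1 \x (@lebesgue_measure R))%E.

Let nu := pushforward m (@rcons_rV R n).

Let mpre A : measurable A -> measurable (@rcons_rV R n @^-1` A).
Proof. by move=> mA; rewrite -[X in measurable X]setTI; exact: measurable_rcons_rV. Qed.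

Let nu0 : nu set0 = 0%E.
Proof. by rewrite /nu /pushforward preimage_set0 measure0. Qed.

Let nu_ge0 A : (0 <= nu A)%E.
Proof. by rewrite /nu /pushforward. Qed.

Let nu_sigma_additive : semi_sigma_additive nu.
Proof.
move=> F mF tF mUF; rewrite /nu /pushforward preimage_bigcup.
apply: measure_semi_sigma_additive.
- by move=> k; exact: mpre.
- apply/trivIsetP => /= i j _ _ ij; rewrite -preimage_setI.
  by move/trivIsetP : tF => /(_ _ _ _ _ ij) ->//; rewrite preimage_set0.
- by rewrite -preimage_bigcup; exact: mpre.
Qed.

Let m_sigma_finite : sigma_finite setT m.
Proof.
have /sigma_finiteP[F [TF ndF Foo]] := sigma_finiteT m1.
have /sigma_finiteP[G [TG ndG Goo]] := sigma_finiteT (@lebesgue_measure R).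
exists (fun n => F n `*` G n).
  rewrite -setXTT TF TG predeqE => -[x y]; split.
    move=> [/= [k _ Fkx] [i _ Giy]]; exists (maxn k i) => //; split.
    - by move: x Fkx; exact/subsetPset/ndF/leq_maxl.
    - by move: y Giy; exact/subsetPset/ndG/leq_maxr.
  by move=> [k _ []/= ? ?]; split; exists k.
move=> k; have [? ?] := Foo k; have [? ?] := Goo k.
split; first exact: measurableX.
by rewrite /m /= product_measure1E// lte_mul_pinfty// ge0_fin_numE.
Qed.

Let nu_sigma_finite : sigma_finite setT nu.
Proof.
have [F FT Foo] := m_sigma_finite.
exists (fun k => @unrcons_rV R n @^-1` F k).
  by rewrite -preimage_bigcup -FT preimage_setT.
move=> k; have [mFk Fkoo] := Foo k; split.
  by rewrite -[X in measurable X]setTI; exact: measurable_unrcons_rV.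
rewrite /nu /pushforward -comp_preimage (_ : _ \o _ = id) ?preimage_id//.
by apply/funext => z /=; rewrite rcons_rVK.
Qed.

HB.instance Definition _ :=
  isMeasure.Build _ _ _ nu nu0 nu_ge0 nu_sigma_additive.
HB.instance Definition _ :=
  Measure_isSigmaFinite.Build _ _ _ nu nu_sigma_finite.

Lemma rcons_measure_ex :
  exists m' : {sigma_finite_measure set 'rV[R]_n.+1 -> \bar R},
    m' = nu :> (set _ -> \bar R).
Proof. by exists nu. Qed.

End rcons_measure.

Section lebesgue_rV_measure.
Context {R : realType}.

Let ex_lebesgue_rV (n : nat) :
  exists m : {sigma_finite_measure set 'rV[R]_n -> \bar R},
    m = @lebesgue_rV R n :> (set 'rV[R]_n -> \bar R).
Proof.
elim: n => [|n [m mE]].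
  by exists (dirac (0 : 'rV[R]_0)).
have [m' m'E] := rcons_measure_ex m.
by exists m'; rewrite m'E /= -mE.
Qed.

Context (n : nat).

Let lebesgue_rV0 : lebesgue_rV (set0 : set 'rV[R]_n) = 0%E.
Proof. by have [m <-] := ex_lebesgue_rV n; exact: measure0. Qed.

Let lebesgue_rV_ge0 (A : set 'rV[R]_n) : (0 <= lebesgue_rV A)%E.
Proof. by have [m <-] := ex_lebesgue_rV n; exact: measure_ge0. Qed.

Let lebesgue_rV_sigma_additive : semi_sigma_additive (@lebesgue_rV R n).
Proof.
by have [m <-] := ex_lebesgue_rV n; exact: measure_semi_sigma_additive.
Qed.

Let lebesgue_rV_sigma_finite : sigma_finite setT (@lebesgue_rV R n).
Proof. by have [m <-] := ex_lebesgue_rV n; exact: sigma_finiteT. Qed.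

HB.instance Definition _ := isMeasure.Build _ _ _ (@lebesgue_rV R n)
  lebesgue_rV0 lebesgue_rV_ge0 lebesgue_rV_sigma_additive.
HB.instance Definition _ := Measure_isSigmaFinite.Build _ _ _ (@lebesgue_rV R n)
  lebesgue_rV_sigma_finite.

End lebesgue_rV_measure.

Lemma lebesgue_rV_box {R : realType} (n : nat) (A : 'I_n -> set R) :
  (forall i, measurable (A i : set (measurableTypeR R))) ->
  lebesgue_rV [set v : 'rV[R]_n | forall i, A i (v ord0 i)] =
  (\prod_(i < n) (@lebesgue_measure R (A i)))%E.
Proof.
elim: n A => [|n IHn] A mA.
  rewrite big_ord0 /= /dirac indicE mem_set//=.
  by case.
rewrite big_ord_recr /=.
have mbox k (B : 'I_k -> set R) :
    (forall i, measurable (B i : set (measurableTypeR R))) ->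
    measurable [set v : 'rV[R]_k | forall i, B i (v ord0 i)].
  move=> mB; rewrite (_ : [set _ | _] =
      \big[setI/setT]_(i < k) ((fun v : 'rV[R]_k => v ord0 i) @^-1` B i)).
    apply: bigsetI_measurable => i _; rewrite -[X in measurable X]setTI.
    exact: (@measurable_coord_rV R k i).
  by rewrite -bigcap_seq; apply/seteqP; split=> [v Bv i _|v Bv i];
    [exact: Bv|apply: Bv; rewrite /= mem_index_enum].
pose A' (i : 'I_n) := A (widen_ord (leqnSn n) i).
rewrite /pushforward (_ : _ @^-1` _ =
    [set v : 'rV[R]_n | forall i, A' i (v ord0 i)] `*` A ord_max).
  transitivity (lebesgue_rV [set v : 'rV[R]_n | forall i, A' i (v ord0 i)] *
      lebesgue_measure (A ord_max : set (measurableTypeR R)))%E.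
    by apply: product_measure1E => //; apply: mbox => i; exact: mA.
  by rewrite IHn// => i; exact: mA.
have wl i : widen_ord (leqnSn n) i = lift ord_max i.
  by apply/val_inj; rewrite /= /bump leqNgt ltn_ord.
apply/seteqP; split=> [[v x] /= Av|[v x] /= [Av Ax] i].
  split=> [i|].
  - by have := Av (lift ord_max i); rewrite mxE liftK /A' wl.
  - by have := Av ord_max; rewrite mxE unlift_none.
rewrite mxE; case: (unliftP ord_max i) => [j|] ->//=.
by have := Av j; rewrite /A' wl.
Qed.

Section derivatives.
Context {R : realType}.

(* Euclidean norm; the library's `|x| on 'rV_n is the max-norm. *)
Definition enorm n (x : 'rV[R]_n) : R :=
  Num.sqrt (\sum_(i < n) x ord0 i ^+ 2).

Definition mdeg n (b : 'I_n -> nat) : nat := \sum_(i < n) b i.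

Definition madd1 n (b : 'I_n -> nat) (i : 'I_n) : 'I_n -> nat :=
  fun k => (b k + (k == i))%N.

Definition mnat n m (b : {ffun 'I_n -> 'I_m}) : 'I_n -> nat := fun i => b i.

(* D_(e 0)^(b 0) D_(e 1)^(b 1) ... w *)
Definition mderive n (V : normedModType R) (e : 'I_n -> V) (b : 'I_n -> nat)
    (w : V -> R) : V -> R :=
  foldr (fun i f => iter (b i) (fun g z => 'D_(e i) g z) f) w (enum 'I_n).

Definition unit_rV n (i : 'I_n) : 'rV[R]_n := delta_mx ord0 i.

End derivatives.

Section domains.
Context {R : realType} {N : nat}.
Implicit Types (Om : set 'rV[R]_N) (l rho M : R).

Definition is_domain Om := [/\ open Om, connected Om & Om !=set0].

(* g is of class C^l on all of R^n, with all bounds given by M.  For l < 1, C^l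
   alone means Holder continuity and allows cusps: a smooth boundary is
   required to be at least C^1, hence maxn 1 m, which is m when l > 1. *)
Definition Cl_fun n l M (g : 'rV[R]_n -> R) :=
  let m := Num.truncn l in
  [/\ forall b i y, (mdeg b < maxn 1 m)%N ->
        is_derive y (unit_rV i) (mderive (@unit_rV R n) b g)
          (mderive (@unit_rV R n) (madd1 b i) g y),
      forall b, (mdeg b <= maxn 1 m)%N ->
        continuous (mderive (@unit_rV R n) b g),
      forall b y, (mdeg b <= maxn 1 m)%N ->
        `|mderive (@unit_rV R n) b g y| <= M &
      forall b y y', mdeg b = m ->
        `|mderive (@unit_rV R n) b g y - mderive (@unit_rV R n) b g y'|
          <= M * enorm (y - y') `^ (l - m%:R)].

(* In the Cartesian coordinates y = ((x - x0) *m Q, (x - x0) *m e) centred at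
   x0, the set Om is the region above the graph of g inside the ball of radius
   rho.  Taking g on the whole of R^(N-1) is no restriction: multiply by a
   cutoff function and decrease rho. *)
Definition graph_chart l Om (x0 : 'rV[R]_N) rho M :=
  exists (Q : 'M[R]_(N, N.-1)) (e : 'cV[R]_N) (g : 'rV[R]_N.-1 -> R),
  [/\ Q^T *m Q = 1%:M, e^T *m e = 1%:M, Q^T *m e = 0, Cl_fun l M g &
      forall x, enorm (x - x0) < rho ->
        Om x <-> g ((x - x0) *m Q) < ((x - x0) *m e) ord0 ord0].

Definition bdry Om := closure Om `\` interior Om.

(* Boundary of class C^l.  If the boundary is unbounded, the radius and the
   constant of the charts are required to be uniform (this excludes cusps at
   infinity); for a bounded boundary this is automatic by compactness. *)
Definition Cl_boundary l Om :=
  (forall x0, bdry Om x0 -> exists rho M, 0 < rho /\ graph_chart l Om x0 rho M) /\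
  (~ bounded_set (bdry Om) ->
     exists rho M, 0 < rho /\
       forall x0, bdry Om x0 -> graph_chart l Om x0 rho M).

End domains.

Section parabolic_holder.
Context {R : realType} {N : nat}.
Implicit Types (Om : set 'rV[R]_N) (T l : R) (u w : 'rV[R]_N * R -> R).

Definition cyl Om T : set ('rV[R]_N * R) := Om `*` `]0, T[.
Definition ccyl Om T : set ('rV[R]_N * R) := closure Om `*` `[0, T].

(* Parabolic degree |b| + 2j of D_t^j D_x^b. *)
Definition pdeg (j : nat) (b : 'I_N -> nat) : nat := (mdeg b + 2 * j)%N.

Definition DtDx (j : nat) (b : 'I_N -> nat) u : 'rV[R]_N * R -> R :=
  iter j (fun g z => 'D_((0 : 'rV[R]_N), (1 : R)) g z)
    (mderive (fun i => (unit_rV i, 0 : R)) b u).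

(* D_t^j D_x^b u on the closed cylinder: the derivative is taken in the open
   cylinder and extended to the closed one by continuity. *)
Definition cDtDx Om T j b u : 'rV[R]_N * R -> R :=
  fun z => lim (DtDx j b u @ within (cyl Om T) (nbhs z)).

Definition max_norm Om T w : \bar R :=
  ereal_sup [set (`|w z|)%:E | z in ccyl Om T].

Definition holder_x Om T (gam : R) w : \bar R :=
  ereal_sup [set r | exists x y t,
    [/\ closure Om x, closure Om y, t \in `[0, T], x != y &
        r = (`|w (x, t) - w (y, t)| / enorm (x - y) `^ gam)%:E]].

Definition holder_t Om T (gam : R) w : \bar R :=
  ereal_sup [set r | exists x t s,
    [/\ closure Om x, t \in `[0, T], s \in `[0, T], t != s &
        r = (`|w (x, t) - w (x, s)| / `|t - s| `^ gam)%:E]].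

Local Open Scope ereal_scope.

Definition norm_m Om T (m : nat) u : \bar R :=
  \sum_(b : {ffun 'I_N -> 'I_m.+1})
    \sum_(j < m.+1 | (pdeg j (mnat b) <= m)%N)
      max_norm Om T (cDtDx Om T j (mnat b) u).

Definition seminorm_x Om T (m : nat) (a : R) u : \bar R :=
  \sum_(b : {ffun 'I_N -> 'I_m.+1})
    \sum_(j < m.+1 | (pdeg j (mnat b) <= m <= pdeg j (mnat b) + 1)%N)
      holder_x Om T a (cDtDx Om T j (mnat b) u).

Definition seminorm_t Om T (m : nat) (a : R) u : \bar R :=
  \sum_(b : {ffun 'I_N -> 'I_m.+1})
    \sum_(j < m.+1 | (pdeg j (mnat b) <= m <= pdeg j (mnat b) + 1)%N)
      holder_t Om T (((m - pdeg j (mnat b))%:R + a) / 2)%R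
        (cDtDx Om T j (mnat b) u).

Definition holder_norm Om T l u : \bar R :=
  let m := Num.truncn l in let a := (l - m%:R)%R in
  norm_m Om T m u + seminorm_x Om T m a u + seminorm_t Om T m a u.

(* The space C^(l, l/2) of the closed cylinder.  By the symmetry of continuous
   mixed derivatives, the first two clauses amount to the existence of all
   D_t^j D_x^b u with |b| + 2j <= m. *)
Definition holder_space Om T l u : Prop :=
  let m := Num.truncn l in
  [/\ forall j b i z, (pdeg j b + 1 <= m)%N -> cyl Om T z ->
        is_derive z (unit_rV i, 0%R : R) (DtDx j b u) (DtDx j (madd1 b i) u z),
      forall j b z, (pdeg j b + 2 <= m)%N -> cyl Om T z ->
        is_derive z (0%R : 'rV[R]_N, 1%R : R) (DtDx j b u) (DtDx j.+1 b u z),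
      forall j b z, (pdeg j b <= m)%N -> ccyl Om T z ->
        cvg (DtDx j b u @ within (cyl Om T) (nbhs z)),
      {within ccyl Om T, continuous u} &
      holder_norm Om T l u < +oo].

End parabolic_holder.

Section lebesgue_norms.
Context {R : realType} {N : nat}.
Implicit Types (Om : set 'rV[R]_N) (T p : R) (u : 'rV[R]_N * R -> R).
Local Open Scope ereal_scope.

Definition lebesgue_xt :
    {measure set ('rV[R]_N * measurableTypeR R)%type -> \bar R} :=
  @lebesgue_rV R N \x @lebesgue_measure R.

Definition Lp_space_cyl p Om T u : Prop :=
  (u \_ (cyl Om T) : _ -> R) \in Lfun lebesgue_xt p%:E.

Definition Lp_norm_cyl p Om T u : \bar R :=
  'N[lebesgue_xt]_p%:E[EFin \o (u \_ (cyl Om T))].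

Definition Lp_norm p Om (v : 'rV[R]_N -> R) : \bar R :=
  'N[@lebesgue_rV R N]_p%:E[EFin \o (v \_ Om)].

Definition sup_Lp_norm p Om T u : \bar R :=
  ereal_sup [set Lp_norm p Om (fun x => u (x, t)) | t in `]0%R, T[].

End lebesgue_norms.

(* Main.v *)
(* Finite differences replace the Taylor expansion.  At a point (x, t) with
   mu = |u (x, t)| > 0, write K for the Hoelder norm and m for the integer part
   of l.  The (m+1)-th difference of u along a spatial step h, and the
   ([m/2]+1)-th difference along a time step tau with |tau| <= |h|^2, are
   O(K |h|^l).  Choosing |h| ~ rho = eps (mu / K)^(1/l) makes them a small
   fraction of mu, so for every admissible (h, tau) one of the finitely many
   other nodes (x + k h, t + i tau), k, i >= 1, carries a value at least c mu.
   By a uniform interior cone condition the steps h fill a cube of side ~ rho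
   and the tau an interval of length rho^2.  Since (h, tau) |-> (x + k h, t + i tau)
   does not shrink volume, {|u| > c mu} has measure at least c' rho^(N+2), and
   Chebyshev's inequality bounds the L_p norm from below, which is (i).  With t
   kept fixed the exponent N+2 becomes N, which is (ii). *)

Require Import Defs.
From mathcomp Require Import all_boot all_order all_algebra.
From mathcomp Require Import all_classical all_reals all_analysis.
From mathcomp Require Import measurable_realfun.
From mathcomp Require Import ring lra.
Set Implicit Arguments.
Unset Strict Implicit.
Unset Printing Implicit Defensive.

Import Order.TTheory GRing.Theory Num.Theory.
Import numFieldNormedType.Exports.
Local Open Scope classical_set_scope.
Local Open Scope ring_scope.

(** * Finite differences *)

Lemma is_derive_line {R : numFieldType} {V W : normedModType R} (f : V -> W)
    (p v : V) (s : R) (d : W) :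
  is_derive (p + s *: v) v f d -> is_derive s 1 (fun s => f (p + s *: v)) d.
Proof.
move=> [df <-]; have e : (fun h => h^-1 *: ((f \o shift (p + s *: v)) (h *: v)
    - f (p + s *: v))) = (fun h : R => h^-1 *: (((fun s => f (p + s *: v)) \o
    shift s) (h *: 1) - f (p + s *: v))).
  apply/funext => h /=; congr (_ *: (f _ - _)).
  by rewrite scalerDl -mulr_algl scaler1 mulr1 addrCA.
by split; rewrite /derivable /derive -e.
Qed.

Section finite_differences.
Context {R : realType}.
Implicit Types (f : R -> R) (a b s x H lam : R).

(** Unit steps suffice: the actual step [h] or [tau] is absorbed into the function, as in
    [s |-> u (x + s *: h, t)]. *)
Fixpoint fdiff n f x : R :=
  if n is n'.+1 then fdiff n' f (x + 1) - fdiff n' f x else f x.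

(** In the [n]-th difference the value [f s] has coefficient 1 or -1, and the other binomial
    coefficients add up to less than [2 ^+ n]. The induction carries along the companion bound on
    [fdiff n f s] when all nodes, [s] included, are bounded by [lam]. *)
Lemma fdiff_lower_bound n f s lam : 0 <= lam ->
  (forall k, (0 < k <= n)%N -> `|f (s + k%:R)| <= lam) ->
  `|f s| <= `|fdiff n f s| + 2 ^+ n * lam.
Proof.
move=> lam0; suff [//] : (forall s, (forall k, (k <= n)%N ->
    `|f (s + k%:R)| <= lam) -> `|fdiff n f s| <= 2 ^+ n * lam) /\
  (forall s, (forall k, (0 < k <= n)%N -> `|f (s + k%:R)| <= lam) ->
    `|f s| <= `|fdiff n f s| + 2 ^+ n * lam).
  by move=> _; apply.
elim: n {s} => [|n [IHu IHl]].
  split=> s fs /=; first by have := fs 0%N isT; rewrite addr0 expr0 mul1r.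
  by rewrite expr0 mul1r lerDl.
have up s : (forall k, (0 < k <= n.+1)%N -> `|f (s + k%:R)| <= lam) ->
    `|fdiff n f (s + 1)| <= 2 ^+ n * lam.
  move=> fs; apply: IHu => k kn; rewrite -addrA nat1r; exact: fs.
split=> s fs /=; rewrite exprS.
  have h1 := up s (fun k kn => fs k (andP kn).2).
  have h2 := IHu s (fun k kn => fs k (leqW kn)).
  rewrite (le_trans (ler_normB _ _))//; lra.
have h1 := up s fs.
have := lerB_dist (fdiff n f s) (fdiff n f (s + 1)); rewrite distrC.
have h2 : `|f s| <= `|fdiff n f s| + 2 ^+ n * lam.
  by apply: IHl => k /andP[k0 kn]; apply: fs; rewrite k0 leqW.
lra.
Qed.

Lemma is_derive_fdiff n f f' s :
  (forall k, (k <= n)%N -> is_derive (s + k%:R) 1 f (f' (s + k%:R))) ->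
  is_derive s 1 (fdiff n f) (fdiff n f' s).
Proof.
elim: n s => [|n IH] s df; first by have := df 0%N isT; rewrite addr0.
have d1 := IH s (fun k kn => df k (leqW kn)).
have d2 : is_derive (s + 1) 1 (fdiff n f) (fdiff n f' (s + 1)).
  apply: IH => k kn; rewrite -addrA nat1r; exact: df.
have e : (fun x => fdiff n f (x + 1)) = (fun x => fdiff n f (1 + x *: 1)).
  by apply/funext => x; rewrite -mulr_algl scaler1 mulr1 addrC.
apply: is_deriveB; rewrite e; apply: is_derive_line.
by rewrite -mulr_algl scaler1 mulr1 addrC.
Qed.

(* By the mean value theorem each step of the difference becomes a derivative
   at an intermediate point, so no binomial constant appears. *)
Lemma fdiff_le n (phi : nat -> R -> R) s H :
  (forall k x, (k < n)%N -> s <= x <= s + n.+1%:R ->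
    is_derive x 1 (phi k) (phi k.+1 x)) ->
  (forall x, s <= x <= s + n%:R -> `|phi n (x + 1) - phi n x| <= H) ->
  `|fdiff n.+1 (phi 0%N) s| <= H.
Proof.
elim: n phi s => [|n IH] phi s dphi phiH.
  by apply: phiH; rewrite addr0 lexx.
pose psi := fdiff n.+1 (phi 0%N).
have dpsi x : s <= x <= s + 1 ->
    is_derive x 1 psi (fdiff n.+1 (phi 1%N) x).
  move=> /andP[sx xs]; apply: is_derive_fdiff => k kn; apply: dphi => //.
  rewrite (le_trans sx) ?lerDl//=.
  have : k%:R <= n.+1%:R :> R by rewrite ler_nat.
  by rewrite -(natr1 n.+1); lra.
have [|||c cs] := @MVT_segment R psi (fdiff n.+1 (phi 1%N)) s (s + 1).
- by rewrite lerDl.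
- move=> x; rewrite in_itv/= => /andP[sx xs]; apply: dpsi; lra.
- apply: derivable_within_continuous => x; rewrite in_itv/= => xs.
  by have [] := dpsi x xs.
rewrite (_ : s + 1 - s = 1) ?mulr1; last by lra.
move=> e; rewrite [X in `|X|](_ : _ = psi (s + 1) - psi s)// e.
move: cs; rewrite in_itv/= => /andP[sc cs].
(* The intermediate point [c] moves the base by at most 1, so the remaining [n.+1] steps from [c]
   stay in the interval allowed from [s]. *)
apply: (IH (fun k => phi k.+1)) => [k x kn /andP[cx xc]|x /andP[cx xc]].
  apply: dphi => //; rewrite (le_trans sc)//=.
  by rewrite -(natr1 n.+1); lra.
apply: phiH; rewrite (le_trans sc)//= -natr1; lra.
Qed.

End finite_differences.

(** * Partial derivatives *)

Section partial_derivatives.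
Context {R : realType}.

Lemma rV_norm_leP n (v : 'rV[R]_n) (e : R) : 0 <= e ->
  `|v| <= e <-> forall j, `|v ord0 j| <= e.
Proof.
move=> e0; rewrite [`|v|]/Num.norm/= mx_normrE.
split=> [/bigmax_leP[_ ve] j|ve]; first exact: (ve (ord0, j)).
by apply/bigmax_leP; split=> // -[i j] _; rewrite (ord1 i); exact: ve.
Qed.

Lemma rV_norm_ltP n (v : 'rV[R]_n) (e : R) : 0 < e ->
  `|v| < e <-> forall j, `|v ord0 j| < e.
Proof.
move=> e0; rewrite [`|v|]/Num.norm/= mx_normrE.
split=> [/bigmax_ltP[_ ve] j|ve]; first exact: (ve (ord0, j)).
by apply/bigmax_ltP; split=> // -[i j] _; rewrite (ord1 i); exact: ve.
Qed.

Lemma coord_le_norm n (v : 'rV[R]_n) j : `|v ord0 j| <= `|v|.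
Proof. by move: j; apply/rV_norm_leP. Qed.

(** The endpoints are left unordered because the coordinate increments below may have either
    sign. *)
Lemma MVT_sym (f df : R -> R) (a b : R) :
  (forall x, `|x - a| <= `|b - a| -> is_derive x 1 f (df x)) ->
  exists2 c, `|c - a| <= `|b - a| & f b - f a = df c * (b - a).
Proof.
move=> fdf; have [ab|/ltW ba] := leP a b.
  have d x : x \in `[a, b] -> `|x - a| <= `|b - a|.
    by rewrite in_itv/= => /andP[ax xb]; rewrite !ger0_norm ?subr_ge0// lerD2r.
  have [||c cab ->] := @MVT_segment R f df a b ab.
  - by move=> x xab; apply/fdf/d; exact: subset_itv_oo_cc xab.
  - by apply: derivable_within_continuous => x /d/fdf[].
  - by exists c => //; exact: d.
have d x : x \in `[b, a] -> `|x - a| <= `|b - a|.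
  rewrite in_itv/= => /andP[ax xb].
  by rewrite !ler0_norm ?subr_le0// lerN2 lerD2r.
have [||c cab e] := @MVT_segment R f df b a ba.
- by move=> x xab; apply/fdf/d; exact: subset_itv_oo_cc xab.
- by apply: derivable_within_continuous => x /d/fdf[].
- by exists c; [exact: d|rewrite -opprB e -mulrN opprB].
Qed.

(** Move from [x] to [y] by changing one coordinate at a time and apply the mean value theorem on
    each leg. The path never leaves the coordinate box spanned by [x] and [y], so derivatives are
    required only there. *)
Lemma coordinate_increment n (G : 'rV[R]_n -> R) (dG : 'I_n -> 'rV[R]_n -> R)
    (x y : 'rV[R]_n) :
  (forall i (z : 'rV[R]_n),
      (forall j, `|z ord0 j - x ord0 j| <= `|y ord0 j - x ord0 j|) ->
    is_derive z (unit_rV i) G (dG i z)) ->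
  exists xi : 'I_n -> 'rV[R]_n,
    (forall i j, `|xi i ord0 j - x ord0 j| <= `|y ord0 j - x ord0 j|) /\
    G y - G x = \sum_(i < n) dG i (xi i) * (y ord0 i - x ord0 i).
Proof.
move=> Gd.
(* The [k]-th corner of the path: the first [k] coordinates are already those of [y]. *)
pose p k : 'rV[R]_n := \row_j (if (j < k)%N then y ord0 j else x ord0 j).
have p0 : p 0%N = x by apply/rowP => j; rewrite mxE.
have pn : p n = y by apply/rowP => j; rewrite mxE ltn_ord.
have step (i : 'I_n) : exists xi : 'rV[R]_n,
    (forall j, `|xi ord0 j - x ord0 j| <= `|y ord0 j - x ord0 j|) /\
    G (p i.+1) - G (p i) = dG i xi * (y ord0 i - x ord0 i).
  have pS : p i.+1 = p i + (y ord0 i - x ord0 i) *: unit_rV i.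
    apply/rowP => j; rewrite !mxE eqxx/= ltnS leq_eqVlt.
    have [->|ij] := eqVneq j i; first by rewrite eqxx ltnn mulr1 addrC subrK.
    by rewrite (inj_eq val_inj) (negbTE ij) mulr0 addr0.
  have inb c : `|c| <= `|y ord0 i - x ord0 i| -> forall j,
      `|(p i + c *: unit_rV i) ord0 j - x ord0 j| <= `|y ord0 j - x ord0 j|.
    move=> cb j; rewrite !mxE eqxx/=.
    have [->|ij] := eqVneq j i; first by rewrite ltnn mulr1 addrC addKr.
    by rewrite mulr0 addr0; case: ifP; rewrite ?subrr ?normr0.
  have [c cb e] : exists2 c, `|c - 0| <= `|y ord0 i - x ord0 i - 0| &
      G (p i + (y ord0 i - x ord0 i) *: unit_rV i) - G (p i + 0 *: unit_rV i) =
      dG i (p i + c *: unit_rV i) * (y ord0 i - x ord0 i - 0).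
    apply: (@MVT_sym (fun s => G (p i + s *: unit_rV i))
      (fun s => dG i (p i + s *: unit_rV i))) => c cb.
    by apply/is_derive_line/Gd/inb; rewrite !subr0 in cb.
  rewrite !subr0 scale0r addr0 in cb e.
  by exists (p i + c *: unit_rV i); split; [exact: inb|rewrite pS].
have /boolp.choice[xi xiP] := step.
exists xi; split=> [i|]; first by case: (xiP i).
under eq_bigr do rewrite -(xiP _).2.
rewrite -(big_mkord xpredT (fun k => G (p k.+1) - G (p k))).
by rewrite telescope_sumr// p0 pn.
Qed.

Lemma bounded_partials_lipschitz n (G : 'rV[R]_n -> R)
    (dG : 'I_n -> 'rV[R]_n -> R) (M : R) :
  (forall i z, is_derive z (unit_rV i) G (dG i z)) ->
  (forall i z, `|dG i z| <= M) ->
  forall x y, `|G y - G x| <= M * \sum_(i < n) `|y ord0 i - x ord0 i|.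
Proof.
move=> Gd dM x y.
have [xi [_ ->]] := @coordinate_increment n G dG x y (fun i z _ => Gd i z).
rewrite mulr_sumr (le_trans (ler_norm_sum _ _ _))//; apply: ler_sum => i _.
by rewrite normrM ler_wpM2r.
Qed.

(** By [coordinate_increment] the difference quotient along [v] is a combination of partial
    derivatives at points that tend to [x] with the step. This supplies derivatives along an
    arbitrary [h], whereas the Hoelder space only provides them along the axes. *)
Lemma is_derive_continuous_partials n (G : 'rV[R]_n -> R)
    (dG : 'I_n -> 'rV[R]_n -> R) (x v : 'rV[R]_n) :
  (\forall z \near x, forall i, is_derive z (unit_rV i) G (dG i z)) ->
  (forall i, {for x, continuous (dG i)}) ->
  is_derive x v G (\sum_(i < n) v ord0 i * dG i x).
Proof.
move=> Gd dGc.
set D := \sum_(i < n) _.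
suff cv : h^-1 *: ((G \o shift x) (h *: v) - G x) @[h --> 0^'] --> D.
  by split; [apply/cvg_ex; exists D|exact: cvg_lim].
apply/cvgrPdist_le => e e0.
(* The summand 1 keeps [S] positive even when [v] is zero. *)
pose S := \sum_(i < n) `|v ord0 i| + 1.
have S0 : 0 < S by rewrite ltr_wpDl// sumr_ge0.
have /nbhs_ballP[d /= d0 dP] : \forall z \near x,
    (forall i, is_derive z (unit_rV i) G (dG i z)) /\
    (forall i, `|dG i z - dG i x| <= e / S).
  near=> z; split; first by near: z.
  near: z; apply: filter_forall => i.
  have /cvgrPdist_le/(_ (e / S)) := dGc i.
  rewrite divr_gt0// => /(_ isT); apply: filterS => z; by rewrite distrC.
near=> h.
have h0 : h != 0 by near: h; exact: nbhs_dnbhs_neq.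
have hv : `|h *: v| < d.
  have -> : `|h *: v| = `|h| * `|v| by rewrite normrZ.
  have v1 : 0 < `|v| + 1 by rewrite ltr_wpDl.
  rewrite (@le_lt_trans _ _ (`|h| * (`|v| + 1))) ?ler_wpM2l ?lerDl//.
  by rewrite -ltr_pdivlMr//; near: h; apply: dnbhs0_lt; rewrite divr_gt0.
have hd (z : 'rV[R]_n) : (forall j, `|z ord0 j - x ord0 j| <=
    `|(h *: v + x) ord0 j - x ord0 j|) -> ball x d z.
  move=> zP; rewrite -ball_normE/= -opprB normrN.
  apply/rV_norm_ltP => // j; rewrite !mxE (le_lt_trans (zP j))//.
  by rewrite mxE addrK (le_lt_trans (coord_le_norm _ _)).
have [xi [xiP e1]] := @coordinate_increment n G dG x (h *: v + x)
  (fun i z zP => (dP z (hd z zP)).1 i).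
rewrite /= e1 scaler_sumr -sumrB (le_trans (ler_norm_sum _ _ _))//.
apply: (@le_trans _ _ (\sum_(i < n) `|v ord0 i| * (e / S))).
  apply: ler_sum => i _.
  have [_ /(_ i) dxi] := dP (xi i) (hd _ (xiP i)).
  rewrite !mxE addrK (_ : _ - _ = v ord0 i * (dG i x - dG i (xi i))).
    by rewrite normrM ler_wpM2l// distrC.
  by rewrite -mulr_algl scaler1; field.
rewrite -mulr_suml mulrCA ler_piMr ?(ltW e0)// ler_pdivrMr// mul1r /S lerDl.
Unshelve. all: by end_near. Qed.

End partial_derivatives.

(** * The Hoelder norm on the open cylinder *)

Lemma le_sume_nneg {R : realType} (I : finType) (P : pred I) (F : I -> \bar R)
    (i0 : I) : (forall i, P i -> (0 <= F i)%E) -> P i0 ->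
  (F i0 <= \sum_(i | P i) F i)%E.
Proof.
move=> F0 Pi0; rewrite (bigD1 i0)//= leeDl// sume_ge0// => i /andP[Pi _].
exact: F0.
Qed.

(** The filter [nbhs z] is not punctured: every neighbourhood contains [z], so the limit can only be
    [f z]. *)
Lemma cvg_nbhs_continuous {R : realType} {V : topologicalType} (f : V -> R) z :
  cvg (f @ nbhs z) -> {for z, continuous f}.
Proof.
move=> /cvg_ex[y fy]; suff e : f z = y by rewrite /prop_for /continuous_at e.
apply/eqP; rewrite -subr_eq0 -normr_le0; apply/ler_addgt0Pr => e e0.
rewrite add0r; have /cvgrPdist_le/(_ e e0)/nbhs_singleton/= := fy.
by rewrite distrC.
Qed.

Lemma mderive0 {R : realType} n (V : normedModType R) (e : 'I_n -> V)
    (w : V -> R) : mderive e (fun=> 0%N) w = w.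
Proof. by rewrite /mderive; elim: (enum 'I_n) => //= i s ->. Qed.

Lemma mdeg0 n : mdeg (fun _ : 'I_n => 0%N) = 0%N.
Proof. by rewrite /mdeg big1. Qed.

Lemma mdeg_madd1 n (b : 'I_n -> nat) i : mdeg (madd1 b i) = (mdeg b).+1.
Proof.
rewrite /mdeg /madd1 big_split/= -addn1; congr addn.
by rewrite (bigD1 i)//= eqxx big1// => j /negbTE ->.
Qed.

Section holder_space_on_cylinder.
Context {R : realType} {N : nat}.
Variables (Om : set 'rV[R]_N) (T l : R).
Hypotheses (N_gt0 : (0 < N)%N) (T_gt0 : 0 < T) (oOm : open Om)
  (Om0 : Om !=set0).
Let m := Num.truncn l.
Let a := l - m%:R.

Lemma DtDx00 (u : 'rV[R]_N * R -> R) : DtDx 0 (fun=> 0%N) u = u.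
Proof. by rewrite /DtDx /= mderive0. Qed.

Lemma open_cyl : open (cyl Om T).
Proof.
rewrite openE => -[x t] [/= Ox tT]; exists (Om, `]0, T[%classic) => //=.
by split; apply: open_nbhs_nbhs; split => //; exact: interval_open.
Qed.

Lemma cyl_sub_ccyl : cyl Om T `<=` ccyl Om T.
Proof.
move=> [x t] [Ox tT]; split; first exact: subset_closure.
exact: subset_itv_oo_cc tT.
Qed.

Lemma cyl_nonempty : cyl Om T !=set0.
Proof.
have [x Ox] := Om0; exists (x, T / 2); split => //=.
by rewrite in_itv/= divr_gt0//= ltr_pdivrMr// ltr_pMr// ltr1n.
Qed.

(** Provides an admissible pair for the supremum in [holder_x]; a positive dimension is what
    separates the two points. *)
Lemma open_two_points : exists x y, [/\ Om x, Om y & x != y].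
Proof.
have [x Ox] := Om0; have /nbhs_ballP[d /= d0 dO] := open_nbhs_nbhs (conj oOm Ox).
exists x, (x + const_mx (d / 2)); split => //.
  apply: dO; rewrite -ball_normE/= opprD addNKr normrN.
  apply/rV_norm_ltP => // j; rewrite mxE ger0_norm ?ltW ?ltr_pdivrMr//.
  - by rewrite ltr_pMr ?ltr1n.
  - by rewrite divr_gt0.
rewrite -subr_eq0 opprD addNKr oppr_eq0; apply/eqP => /rowP/(_ (Ordinal N_gt0)).
by rewrite !mxE; apply/eqP; rewrite gt_eqF// divr_gt0.
Qed.

(** The supremum of an empty set is [-oo], so this and the next two facts each exhibit a competitor.
    Nonnegativity then allows single terms to be compared with the whole Hoelder norm. *)
Lemma max_norm_ge0 w : (0 <= max_norm Om T w)%E.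
Proof.
have [z /cyl_sub_ccyl cz] := cyl_nonempty.
apply: (@le_trans _ _ (`|w z|)%:E); rewrite ?lee_fin//.
by apply: ereal_sup_ubound; exists z.
Qed.

Lemma holder_x_ge0 g w : (0 <= holder_x Om T g w)%E.
Proof.
have [x [y [Ox Oy xy]]] := open_two_points.
apply: (@le_trans _ _ (`|w (x, 0) - w (y, 0)| / enorm (x - y) `^ g)%:E).
  by rewrite lee_fin divr_ge0// powR_ge0.
apply: ereal_sup_ubound; exists x, y, 0; split => //; try exact: subset_closure.
by rewrite in_itv/= lexx ltW.
Qed.

Lemma holder_t_ge0 g w : (0 <= holder_t Om T g w)%E.
Proof.
have [x Ox] := Om0.
apply: (@le_trans _ _ (`|w (x, 0) - w (x, T)| / `|0 - T| `^ g)%:E).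
  by rewrite lee_fin divr_ge0// powR_ge0.
apply: ereal_sup_ubound; exists x, 0, T; split => //.
- exact: subset_closure.
- by rewrite in_itv/= lexx ltW.
- by rewrite in_itv/= lexx ltW.
- by rewrite lt_eqF.
Qed.

Section one_function.
Variable u : 'rV[R]_N * R -> R.
Hypothesis hu : holder_space Om T l u.
Let K := fine (holder_norm Om T l u).

Lemma norm_m_ge0 : (0 <= norm_m Om T m u)%E.
Proof.
by apply: sume_ge0 => b _; apply: sume_ge0 => j _; exact: max_norm_ge0.
Qed.

Lemma seminorm_x_ge0 : (0 <= seminorm_x Om T m a u)%E.
Proof.
by apply: sume_ge0 => b _; apply: sume_ge0 => j _; exact: holder_x_ge0.
Qed.

Lemma seminorm_t_ge0 : (0 <= seminorm_t Om T m a u)%E.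
Proof.
by apply: sume_ge0 => b _; apply: sume_ge0 => j _; exact: holder_t_ge0.
Qed.

Lemma holder_norm_fin : holder_norm Om T l u = K%:E.
Proof.
rewrite /K fineK//; apply: fin_real; case: hu => _ _ _ _ -> /=.
rewrite andbT (lt_le_trans ltNy0)//.
by rewrite !adde_ge0 ?norm_m_ge0 ?seminorm_x_ge0 ?seminorm_t_ge0.
Qed.

Lemma norm_m_le : (norm_m Om T m u <= K%:E)%E.
Proof.
rewrite -holder_norm_fin /holder_norm -/m -/a -addeA leeDl//.
by rewrite adde_ge0 ?seminorm_x_ge0 ?seminorm_t_ge0.
Qed.

Lemma seminorm_x_le : (seminorm_x Om T m a u <= K%:E)%E.
Proof.
rewrite -holder_norm_fin /holder_norm -/m -/a addeAC leeDr//.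
by rewrite adde_ge0 ?norm_m_ge0 ?seminorm_t_ge0.
Qed.

Lemma seminorm_t_le : (seminorm_t Om T m a u <= K%:E)%E.
Proof.
rewrite -holder_norm_fin /holder_norm -/m -/a leeDr//.
by rewrite adde_ge0 ?norm_m_ge0 ?seminorm_x_ge0.
Qed.

(** Near a point of the open cylinder the filter relative to the cylinder is the full neighbourhood
    filter, so the derivative extended by continuity agrees with the derivative itself. *)
Lemma DtDx_cvg j b z : (pdeg j b <= m)%N -> cyl Om T z ->
  cvg (DtDx j b u @ nbhs z) /\ cDtDx Om T j b u z = DtDx j b u z.
Proof.
move=> jb Cz; have [_ _ /(_ j b z jb (cyl_sub_ccyl Cz)) c _ _] := hu.
have e : within (cyl Om T) (nbhs z) = nbhs z.
  by rewrite within_interior//; exact: open_nbhs_nbhs (conj open_cyl Cz).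
rewrite e in c; split => //.
by rewrite /cDtDx e; apply/cvg_lim => //; exact: cvg_nbhs_continuous.
Qed.

(** The sums in the norms range over multiindices with entries in ['I_m.+1]; a multiindex of degree
    at most [m] is one of them. *)
Lemma mnatK (b : 'I_N -> nat) : (mdeg b <= m)%N ->
  mnat [ffun i => inord (b i) : 'I_m.+1] = b.
Proof.
move=> bm; apply/funext => i; rewrite /mnat ffunE inordK// ltnS.
by rewrite (leq_trans _ bm)// /mdeg (bigD1 i)//= leq_addr.
Qed.

Lemma abs_le_holder z : cyl Om T z -> `|u z| <= K.
Proof.
move=> Cz; rewrite -lee_fin (le_trans _ norm_m_le)//.
pose b : {ffun 'I_N -> 'I_m.+1} := [ffun i => inord 0].
have bE : mnat b = fun=> 0%N by rewrite mnatK// mdeg0.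
have dg : (pdeg 0 (fun _ : 'I_N => 0) <= m)%N by rewrite /pdeg mdeg0.
rewrite (le_trans _ (@le_sume_nneg _ _ xpredT _ b _ isT))//=; last first.
  by move=> c _; apply: sume_ge0 => j _; exact: max_norm_ge0.
rewrite (le_trans _ (@le_sume_nneg _ _ _ _ ord0 _ _))//=.
- apply: ereal_sup_ubound; exists z; first exact: cyl_sub_ccyl.
  by rewrite bE (DtDx_cvg dg Cz).2 DtDx00.
- by move=> c _; exact: max_norm_ge0.
- by rewrite bE.
Qed.

Lemma holder_x_le b x y t : mdeg b = m -> Om x -> Om y -> 0 < t < T ->
  `|DtDx 0 b u (x, t) - DtDx 0 b u (y, t)| <= K * enorm (x - y) `^ a.
Proof.
move=> bm Ox Oy tT; have [->|xy] := eqVneq x y.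
  by rewrite subrr normr0 mulr_ge0 ?powR_ge0// -lee_fin -holder_norm_fin
    !adde_ge0 ?norm_m_ge0 ?seminorm_x_ge0 ?seminorm_t_ge0.
have exy : 0 < enorm (x - y) `^ a.
  rewrite powR_gt0// /enorm sqrtr_gt0 lt_neqAle sumr_ge0 ?andbT; last first.
    by move=> i _; exact: sqr_ge0.
  rewrite eq_sym psumr_eq0; last by move=> i _; exact: sqr_ge0.
  apply: contra xy => /allP xy0; rewrite -subr_eq0; apply/eqP/rowP => i.
  have := xy0 i (mem_index_enum _); rewrite sqrf_eq0 => /eqP ->.
  by rewrite mxE.
rewrite -ler_pdivrMr// -lee_fin (le_trans _ seminorm_x_le)//.
pose c : {ffun 'I_N -> 'I_m.+1} := [ffun i => inord (b i)].
have cE : mnat c = b by rewrite mnatK// bm.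
have dg : pdeg 0 b = m by rewrite /pdeg bm addn0.
rewrite (le_trans _ (@le_sume_nneg _ _ xpredT _ c _ isT))//=; last first.
  by move=> d _; apply: sume_ge0 => j _; exact: holder_x_ge0.
rewrite (le_trans _ (@le_sume_nneg _ _ _ _ ord0 _ _))//=.
- have tT' : t \in `[0, T] by apply: subset_itv_oo_cc; rewrite /= in_itv.
  apply: ereal_sup_ubound; exists x, y, t; split => //; try exact: subset_closure.
  by rewrite cE !(DtDx_cvg _ _).2//= ?dg.
- by move=> d _; exact: holder_x_ge0.
- by rewrite cE dg leqnn leq_addr.
Qed.

(** The derivative of order [m./2] in time has parabolic degree [m - odd m], that is [m] or [m - 1],
    so it occurs in [seminorm_t]. Its exponent there, [(odd m + a) / 2], equals [l / 2 - m./2]. *)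
Lemma holder_t_le x t s : Om x -> 0 < t < T -> 0 < s < T ->
  `|DtDx m./2 (fun=> 0%N) u (x, t) - DtDx m./2 (fun=> 0%N) u (x, s)| <=
  K * `|t - s| `^ (l / 2 - m./2%:R).
Proof.
move=> Ox tT sT; have [->|ts] := eqVneq t s.
  by rewrite subrr normr0 mulr_ge0 ?powR_ge0// -lee_fin -holder_norm_fin
    !adde_ge0 ?norm_m_ge0 ?seminorm_x_ge0 ?seminorm_t_ge0.
have ets : 0 < `|t - s| `^ (l / 2 - m./2%:R).
  by rewrite powR_gt0// normr_gt0 subr_eq0.
rewrite -ler_pdivrMr// -lee_fin (le_trans _ seminorm_t_le)//.
pose b : {ffun 'I_N -> 'I_m.+1} := [ffun i => inord 0].
have bE : mnat b = fun=> 0%N by rewrite mnatK// mdeg0.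
have om : (odd m <= m)%N by case: (m) => // k; case: odd.
have dg : pdeg m./2 (fun _ : 'I_N => 0%N) = (m - odd m)%N.
  apply: (@addnI (odd m)).
  by rewrite /pdeg mdeg0 add0n mul2n odd_double_half subnKC.
have jm : (m./2 < m.+1)%N by rewrite ltnS leq_half_double -addnn leqW// leq_addr.
rewrite (le_trans _ (@le_sume_nneg _ _ xpredT _ b _ isT))//=; last first.
  by move=> d _; apply: sume_ge0 => j _; exact: holder_t_ge0.
rewrite (le_trans _ (@le_sume_nneg _ _ _ _ (Ordinal jm) _ _))//=.
- have i01 r : 0 < r < T -> r \in `[0, T].
    by move=> rT; apply: subset_itv_oo_cc; rewrite /= in_itv.
  apply: ereal_sup_ubound; exists x, t, s; split => //.
  + exact: subset_closure.
  + exact: i01.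
  + exact: i01.
  rewrite bE !(DtDx_cvg _ _).2//= ?dg ?leq_subr//.
  congr (_ / _ `^ _)%:E; rewrite subKn// /a.
  have /(congr1 (fun k => k%:R : R)) := odd_double_half m.
  by rewrite natrD -mul2n natrM => <-; lra.
- by move=> d _; exact: holder_t_ge0.
- by rewrite bE dg leq_subr/= -{1}(subnK om) leq_add2l leq_b1.
Qed.

End one_function.
End holder_space_on_cylinder.

(** * Difference estimates in space and in time *)

Section difference_estimates.
Context {R : realType} {N : nat}.
Variables (Om : set 'rV[R]_N) (T l : R).
Hypotheses (N_gt0 : (0 < N)%N) (T_gt0 : 0 < T) (oOm : open Om)
  (Om0 : Om !=set0).
Let m := Num.truncn l.
Let a := l - m%:R.
Variable u : 'rV[R]_N * R -> R.
Hypothesis hu : holder_space Om T l u.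
Let K := fine (holder_norm Om T l u).

Section space.
Variable h : 'rV[R]_N.

(* (h . D)^k D^b u *)
Fixpoint dirD k (b : 'I_N -> nat) (z : 'rV[R]_N * R) : R :=
  if k is k'.+1 then \sum_(i < N) h ord0 i * dirD k' (madd1 b i) z
  else DtDx 0 b u z.

(** For [k = 0] the derivative [D^b u] has continuous first partials on the slice at time [t], hence
    a derivative along [h]. Larger [k] follow by linearity. *)
Lemma is_derive_dirD k b x t : (mdeg b + k < m)%N -> Om x -> 0 < t < T ->
  is_derive x h (fun x => dirD k b (x, t)) (dirD k.+1 b (x, t)).
Proof.
move=> + Ox tT; elim: k b => [|k IH] b bk; last first.
  have -> : (fun x => dirD k.+1 b (x, t)) =
      \sum_(i < N) (h ord0 i \*: (fun x => dirD k (madd1 b i) (x, t))).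
    by apply/funext => y; rewrite fct_sumE.
  apply: (@is_derive_sum _ _ _ N _ _ _
    (fun i => h ord0 i *: dirD k.+1 (madd1 b i) (x, t))) => i.
  by apply: is_deriveZ; apply: IH; rewrite mdeg_madd1 addSnnS.
rewrite addn0 in bk.
apply: (@is_derive_continuous_partials _ _ _
  (fun i y => DtDx 0 (madd1 b i) u (y, t))).
- have := open_nbhs_nbhs (conj oOm Ox); apply: filterS => y Oy i.
  have [/(_ 0%N b i (y, t)) + _ _ _ _] := hu.
  rewrite /pdeg addn0 addn1 => /(_ bk); case; first by split => //=; rewrite in_itv.
  move=> df <-; have e : (fun r => r^-1 *: ((DtDx 0 b u \o shift (y, t))
      (r *: (unit_rV i, 0)) - DtDx 0 b u (y, t))) =
    (fun r : R => r^-1 *: (((fun x => DtDx 0 b u (x, t)) \o shift y)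
      (r *: unit_rV i) - DtDx 0 b u (y, t))).
    by apply/funext => r /=; congr (_ *: (DtDx 0 b u (_, _) - _)) => /=;
      rewrite scaler0 add0r.
  by split; rewrite /derivable /derive -e.
- move=> i.
  have [//||c _] := DtDx_cvg oOm hu (j := 0) (b := madd1 b i) (z := (x, t)).
  + by rewrite /pdeg mdeg_madd1 addn0.
  + by split => //=; rewrite in_itv.
  have := @continuous_comp 'rV[R]_N ('rV[R]_N * R)%type R (fun y => (y, t))
    (DtDx 0 (madd1 b i) u) x.
  apply; last exact: cvg_nbhs_continuous.
  exact: (@cvg_pair _ _ _ _ (nbhs x) (nbhs t) _ _ _ (fun y => y) (fun=> t)
    cvg_id (cvg_cst t)).
Qed.

Lemma holder_dirD k b x y t : (mdeg b + k = m)%N -> Om x -> Om y -> 0 < t < T ->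
  `|dirD k b (x, t) - dirD k b (y, t)| <=
  (\sum_(i < N) `|h ord0 i|) ^+ k * (K * enorm (x - y) `^ a).
Proof.
move=> + Ox Oy tT; elim: k b => [|k IH] b bk /=.
  by rewrite expr0 mul1r; rewrite addn0 in bk; exact: (holder_x_le N_gt0).
rewrite -sumrB (le_trans (ler_norm_sum _ _ _))// exprS -mulrA mulr_suml.
apply: ler_sum => i _; rewrite -mulrBr normrM ler_wpM2l//.
by apply: IH; rewrite mdeg_madd1 addSnnS.
Qed.

(** Along the segment the functions [(h . D)^k u] are successive derivatives, so the difference of
    order [m.+1] reduces to one increment of [(h . D)^m u] over a step [h]. Hoelder continuity of
    the derivatives of order [m] bounds that increment by a term of size [K |h|^l]. *)
Lemma space_difference_estimate x t lam : 0 < t < T -> 0 <= lam ->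
  (forall s, 0 <= s <= m.+1%:R -> Om (x + s *: h)) ->
  (forall k, (0 < k <= m.+1)%N -> `|u (x + k%:R *: h, t)| <= lam) ->
  `|u (x, t)| <= 2 ^+ m.+1 * lam +
    (\sum_(i < N) `|h ord0 i|) ^+ m * (K * enorm h `^ a).
Proof.
move=> tT lam0 Oh ulam.
pose phi k s := dirD k (fun=> 0%N) (x + s *: h, t).
have phi0 : phi 0%N = fun s => u (x + s *: h, t).
  by apply/funext => s; rewrite /phi /dirD DtDx00.
have -> : u (x, t) = phi 0%N 0 by rewrite phi0 scale0r addr0.
rewrite addrC (le_trans (@fdiff_lower_bound _ m.+1 _ _ lam _ _))//.
  by move=> k km; rewrite phi0 add0r; exact: ulam.
rewrite lerD2r; apply: fdiff_le => [k s km|s].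
  rewrite add0r => s0.
  apply: (is_derive_line (f := fun y => dirD k (fun=> 0%N) (y, t))).
  by apply: is_derive_dirD; [rewrite mdeg0|exact: Oh|].
rewrite add0r => /andP[s0 sm].
rewrite (le_trans (holder_dirD _ _ _ _))// ?mdeg0//.
- by apply: Oh; rewrite addr_ge0//= -natr1 lerD2r.
- by apply: Oh; rewrite s0/= (le_trans sm)// ler_nat.
by rewrite opprD addrACA subrr add0r -scalerBl addrAC subrr add0r scale1r.
Qed.

End space.

(** Same scheme in time with [m./2] derivatives: the last increment contributes
    [|tau|^(l/2 - m./2)], and the chain rule contributes the missing factor [|tau|^(m./2)]. *)
Lemma time_difference_estimate x t tau lam : Om x -> 0 <= lam -> tau != 0 ->
  (forall s, 0 <= s <= m./2.+1%:R -> 0 < t + s * tau < T) ->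
  (forall k, (0 < k <= m./2.+1)%N -> `|u (x, t + k%:R * tau)| <= lam) ->
  `|u (x, t)| <= 2 ^+ m./2.+1 * lam + K * `|tau| `^ (l / 2).
Proof.
move=> Ox lam0 tau0 Tt ulam.
pose phi k s := tau ^+ k * DtDx k (fun=> 0%N) u (x, t + s * tau).
have phi0 : phi 0%N = fun s => u (x, t + s * tau).
  by apply/funext => s; rewrite /phi DtDx00 mul1r.
have -> : u (x, t) = phi 0%N 0 by rewrite phi0 mul0r addr0.
rewrite addrC (le_trans (@fdiff_lower_bound _ m./2.+1 _ _ lam _ _))//.
  by move=> k km; rewrite phi0 add0r; exact: ulam.
rewrite lerD2r; apply: fdiff_le => [k s km|s].
  rewrite add0r => s0.
  have [_ /(_ k (fun=> 0%N) (x, t + s * tau)) + _ _ _] := hu.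
  have km2 : (pdeg k (fun _ : 'I_N => 0) + 2 <= m)%N.
    rewrite /pdeg mdeg0 add0n -[X in (_ + X <= _)%N]muln1 -mulnDr mul2n addn1.
    by rewrite -[leqRHS](odd_double_half m) (leq_trans _ (leq_addl _ _))// leq_double.
  have Cs : cyl Om T (x, t + s * tau) by split => //=; rewrite in_itv /=; exact: Tt.
  move=> /(_ km2 Cs) d1.
  pose g y := DtDx k (fun=> 0%N) u (x, y).
  have xy y : (x, y) = (x, 0) + y *: (0, 1) :> 'rV[R]_N * R.
    by congr pair => /=; rewrite ?scaler0 ?addr0// -mulr_algl scaler1 mulr1 add0r.
  have dg : is_derive (t + s * tau) 1 g (DtDx k.+1 (fun=> 0%N) u (x, t + s * tau)).
    have -> : g = fun y => DtDx k (fun=> 0%N) u ((x, 0) + y *: (0, 1)).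
      by apply/funext => y; rewrite /g xy.
    by apply: is_derive_line; rewrite -xy.
  have da : is_derive s 1 (fun s => t + s * tau) tau.
    have -> : (fun s => t + s * tau) = cst t + tau \*: id.
      by apply/funext => y; rewrite /= mulrC.
    apply: is_derive_eq.
    by rewrite add0r -mulr_algl scaler1 mulr1.
  have -> : phi k = tau ^+ k \*: (g \o (fun s => t + s * tau)) by apply/funext.
  apply: is_derive_eq; rewrite /phi exprSr -mulrA [tau * _]mulrC //.
rewrite add0r => /andP[s0 sm].
rewrite /phi -mulrBr normrM normrX.
rewrite (le_trans (ler_wpM2l _ (holder_t_le N_gt0 T_gt0 oOm Om0 hu Ox _ _)))//.
- by apply: Tt; rewrite addr_ge0//= -natr1 lerD2r.
- by apply: Tt; rewrite s0/= (le_trans sm)// ler_nat.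
rewrite (_ : t + (s + 1) * tau - (t + s * tau) = tau); last by ring.
rewrite mulrCA ler_wpM2l//.
  have Cx : cyl Om T (x, t).
    by split; rewrite //= in_itv/=; have := Tt 0; rewrite mul0r addr0 lexx ler0n; exact.
  exact: le_trans (abs_le_holder N_gt0 T_gt0 oOm Om0 hu Cx).
have tau0' : `|tau| != 0 by rewrite normr_eq0.
rewrite [leRHS](_ : _ = `|tau| `^ m./2%:R * `|tau| `^ (l / 2 - m./2%:R)).
  by rewrite powR_mulrn.
rewrite -powRD; last by rewrite tau0' implybT.
by rewrite addrC subrK.
Qed.

End difference_estimates.

(** * Lebesgue measure under dilations *)

Lemma pushforward_measure_ex {R : realType} d1 d2 (T1 : measurableType d1)
    (T2 : measurableType d2) (m : {measure set T1 -> \bar R}) (f : T1 -> T2) :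
  measurable_fun [set: T1] f ->
  exists m' : {measure set T2 -> \bar R}, m' = pushforward m f :> (set T2 -> \bar R).
Proof.
move=> mf.
by exists (measure_function_pushforward__canonical__measure_function_Measure m mf).
Qed.

Section dilation.
Context {R : realType}.
Local Open Scope ereal_scope.

(** Both sides are measures in [A] that agree on half-open intervals, so uniqueness of Lebesgue
    measure applies. *)
Lemma lebesgue_measure_dilation (x k : R) (A : set (measurableTypeR R)) :
  (0 < k)%R -> measurable A ->
  lebesgue_measure A =
  k%:E * lebesgue_measure ((fun s => x + k * s)%R @^-1` A : set (measurableTypeR R)).
Proof.
move=> k0 mA.
have mf : measurable_fun [set: measurableTypeR R]
    ((fun s => x + k * s)%R : measurableTypeR R -> measurableTypeR R).
  by apply: measurable_funD => //; exact: measurable_funM.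
have [m mE] := pushforward_measure_ex (@lebesgue_measure R) mf.
have -> : lebesgue_measure A = mscale (NngNum (ltW k0)) m A; last first.
  by transitivity (k%:E * m A); [|rewrite mE].
apply: lebesgue_measure_unique mA => _ [[a b]] _ <-.
transitivity (k%:E * m `]a, b]%classic); last by [].
rewrite mE /pushforward (_ : _ @^-1` _ = `]((a - x) / k)%R, ((b - x) / k)%R]%classic).
  rewrite lebesgue_measure_itv/= lebesgue_measure_itv/= !lte_fin.
  rewrite ltr_pM2r ?invr_gt0// ltrD2r.
  case: ifPn => _; last by rewrite mule0.
  by rewrite -!EFinB -EFinM; congr EFin; field; rewrite gt_eqF.
apply/seteqP; split=> s /=; rewrite !in_itv/= ltr_pdivrMr// ler_pdivlMr// => /andP[? ?];
 apply/andP; split; lra.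
Qed.

(** Both sides are measures in [X] that agree on measurable rectangles, which determine the product
    measure. *)
Lemma product_measure_dilation d1 d2 (T1 : measurableType d1)
    (T2 : measurableType d2) (m1 : {sigma_finite_measure set T1 -> \bar R})
    (m2 : {sigma_finite_measure set T2 -> \bar R}) (f : T1 -> T1) (g : T2 -> T2)
    (c1 c2 : R) : (0 <= c1)%R -> (0 <= c2)%R ->
  measurable_fun setT f -> measurable_fun setT g ->
  (forall A, measurable A -> m1 A = c1%:E * m1 (f @^-1` A)) ->
  (forall A, measurable A -> m2 A = c2%:E * m2 (g @^-1` A)) ->
  forall X, measurable X -> (m1 \x m2) X =
    (c1 * c2)%:E * (m1 \x m2) ((fun z => (f z.1, g z.2)) @^-1` X).
Proof.
move=> c10 c20 mf mg fc gc X mX.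
have mfg : measurable_fun setT (fun z : T1 * T2 => (f z.1, g z.2)).
  apply: measurable_fun_pair.
    exact: (measurableT_comp mf measurable_fst).
  exact: (measurableT_comp mg measurable_snd).
have [m mE] := pushforward_measure_ex (m1 \x m2)%E mfg.
have -> : (m1 \x m2) X = mscale (NngNum (mulr_ge0 c10 c20)) m X; last first.
  by transitivity ((c1 * c2)%:E * m X); [|rewrite mE].
apply: product_measure_unique mX => A B mA mB.
transitivity ((c1 * c2)%:E * m (A `*` B)); first by [].
rewrite mE /pushforward.
rewrite (_ : _ @^-1` _ = (f @^-1` A) `*` (g @^-1` B))//.
have mfA : measurable (f @^-1` A) by rewrite -[X in measurable X]setTI; exact: mf.
have mgB : measurable (g @^-1` B) by rewrite -[X in measurable X]setTI; exact: mg.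
transitivity ((c1 * c2)%:E * (m1 (f @^-1` A) * m2 (g @^-1` B))).
  by congr (_ * _); exact: product_measure1E.
by rewrite EFinM muleACA -fc// -gc.
Qed.

Lemma measurable_dilation_rV n (x : 'rV[R]_n) (k : R) :
  measurable_fun [set: 'rV[R]_n] (fun v => x + k *: v)%R.
Proof.
apply: measurable_fun_rVP => i.
rewrite (_ : (fun v => _) = fun v : 'rV[R]_n => (x ord0 i + k * v ord0 i)%R).
  by apply: measurable_funD => //; apply: measurable_funM => //; exact: measurable_coord_rV.
by apply/funext => v; rewrite !mxE.
Qed.

(** Induction on the dimension: a dilation acts separately on the last coordinate and on the others,
    matching the recursive product that defines [lebesgue_rV]. *)
Lemma lebesgue_rV_dilation n (x : 'rV[R]_n) (k : R) (A : set 'rV[R]_n) :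
  (0 < k)%R -> measurable A ->
  lebesgue_rV A = (k ^+ n)%:E * lebesgue_rV ((fun v => x + k *: v)%R @^-1` A).
Proof.
move=> k0; elim: n x A => [|n IH] x A mA.
  rewrite expr0 mul1e; congr lebesgue_rV; apply/seteqP; split => v /=;
  by rewrite (_ : (x + k *: v)%R = v)//; apply/rowP => -[].
rewrite /= /pushforward exprSr.
have mrA : measurable (@rcons_rV R n @^-1` A).
  by rewrite -[X in measurable X]setTI; exact: measurable_rcons_rV.
pose y := unrcons_rV x.
have e (z : 'rV[R]_n * measurableTypeR R) : (x + k *: rcons_rV z =
    rcons_rV (y.1 + k *: z.1, y.2 + k * z.2))%R.
  by apply/rowP => i; rewrite !mxE; case: unliftP => [j|] -> /=; rewrite ?mxE.
have -> : @rcons_rV R n @^-1` ((fun v => x + k *: v)%R @^-1` A) =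
    (fun z => (y.1 + k *: z.1, y.2 + k * z.2)%R) @^-1` (@rcons_rV R n @^-1` A).
  by apply/seteqP; split=> z /=; rewrite e.
apply: (@product_measure_dilation _ _ _ _ (@lebesgue_rV R n) (@lebesgue_measure R)
  (fun v => y.1 + k *: v)%R (fun s => y.2 + k * s)%R (k ^+ n) k
  _ _ _ _ (IH y.1) _ _ mrA).
- by rewrite exprn_ge0 ?ltW.
- exact: ltW.
- exact: measurable_dilation_rV.
- by apply: measurable_funD => //; exact: measurable_funM.
- by move=> B mB; exact: lebesgue_measure_dilation.
Qed.

End dilation.

(** * The uniform interior cone condition *)

Section interior_cones.
Context {R : realType} {N : nat}.
Variables (Om : set 'rV[R]_N) (l : R).
Hypothesis oOm : open Om.

(* nu = 0 is allowed: the truncated cone is then a cube centred at x. *)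
Definition has_cone (e : R) (x : 'rV[R]_N) : Prop :=
  exists nu : 'rV[R]_N, (forall i, `|nu ord0 i| <= 1) /\
    forall (r : R) (v : 'rV[R]_N), 0 <= r <= e ->
      (forall i, `|v ord0 i - nu ord0 i| <= e) ->
      Om (x + r *: v).

Lemma has_cone_le e e' x : e' <= e -> has_cone e x -> has_cone e' x.
Proof.
move=> e'e [nu [nu1 cone]]; exists nu; split=> // r v /andP[r0 re] ve.
apply: cone => [|i]; first by rewrite r0 (le_trans re).
exact: le_trans (ve i) e'e.
Qed.

Lemma enorm_le_sum n (v : 'rV[R]_n) : enorm v <= \sum_i `|v ord0 i|.
Proof.
rewrite /enorm -(ler_pXn2r (n := 2))// ?nnegrE ?sqrtr_ge0 ?sumr_ge0//.
rewrite sqr_sqrtr ?sumr_ge0//; last by move=> i _; exact: sqr_ge0.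
rewrite expr2 mulr_suml; apply: ler_sum => i _.
rewrite -real_normK ?num_real// expr2 ler_wpM2l// (bigD1 i)//= lerDl.
by rewrite sumr_ge0.
Qed.

Lemma sum_coord_le n (v : 'rV[R]_n) (c : R) : (forall i, `|v ord0 i| <= c) ->
  \sum_i `|v ord0 i| <= n%:R * c.
Proof.
move=> vc; rewrite (le_trans (ler_sum _ (fun i _ => vc i)))//.
by rewrite sumr_const card_ord mulr_natl.
Qed.

Lemma orthonormal_coord_le n k (Q : 'M[R]_(n, k)) : Q^T *m Q = 1%:M ->
  forall i j, `|Q i j| <= 1.
Proof.
move=> QQ i j; have e : \sum_a Q^T j a * Q a j = 1.
  by have := congr1 (fun A : 'M[R]_k => A j j) QQ; rewrite !mxE eqxx.
rewrite -(ler_pXn2r (n := 2))// ?nnegrE// expr1n real_normK ?num_real// -[leRHS]e.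
rewrite (bigD1 i)//= mxE -expr2 lerDl sumr_ge0// => a _.
by rewrite mxE -expr2 sqr_ge0.
Qed.

Lemma mulmx_coord_le n k (v : 'rV[R]_n) (Q : 'M[R]_(n, k)) (c : R) j :
  (forall i j, `|Q i j| <= 1) -> (forall i, `|v ord0 i| <= c) ->
  `|(v *m Q) ord0 j| <= n%:R * c.
Proof.
move=> Q1 vc; rewrite mxE (le_trans (ler_norm_sum _ _ _))//.
rewrite (le_trans _ (sum_coord_le vc))//; apply: ler_sum => i _.
by rewrite normrM ler_piMr.
Qed.

(** The bound [maxn 1 m] in [Cl_fun] controls the first partials even when [l < 1]. *)
Lemma Cl_fun_lipschitz n M (g : 'rV[R]_n -> R) : Cl_fun l M g ->
  forall x y, `|g y - g x| <= M * \sum_i `|y ord0 i - x ord0 i|.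
Proof.
case=> dg _ gM _.
apply: (@bounded_partials_lipschitz _ _ _
  (fun i => mderive (@unit_rV R n) (madd1 (fun=> 0%N) i) g)).
- move=> i z; have := dg (fun=> 0%N) i z.
  by rewrite mderive0 mdeg0 leq_max => /(_ isT).
- by move=> i z; apply: gM; rewrite mdeg_madd1 mdeg0 leq_max.
Qed.

(** The cone axis is the vertical direction of the chart. Moving by [r *: v] with [v] close to the
    axis raises the height by almost [r], while the Lipschitz graph rises by at most a small
    multiple of [r]. The aperture depends only on [rho] and [M], hence is uniform over charts with
    these constants. *)
Lemma chart_has_cone rho M : 0 < rho -> exists2 e : R, 0 < e &
  forall x0, graph_chart l Om x0 rho M ->
    forall x, Om x -> `|x - x0| < e -> has_cone e x.
Proof.
move=> rho0.
pose n : R := N%:R; have n0 : 0 <= n by [].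
(* With [e = 1 / S] each summand of [S] secures one requirement: [e <= 1]; both [x] and [x + r *: v]
   stay in the chart ball, their coordinates differing from those of [x0] by at most [3 * e]; and
   the graph does not overtake the point. *)
pose S := 1 + (3 * n + 1) / rho + (`|M| * n ^+ 2 + n).
have A0 : 0 <= (3 * n + 1) / rho by rewrite divr_ge0// ?(ltW rho0)// addr_ge0// mulr_ge0.
have B0 : 0 <= `|M| * n ^+ 2 + n by rewrite addr_ge0// mulr_ge0// exprn_ge0.
have S0 : 0 < S by rewrite /S; lra.
have e0 : 0 < S^-1 by rewrite invr_gt0.
exists S^-1 => //; set e := S^-1 in e0 *.
have eS X : X <= S -> e * X <= 1.
  by move=> XS; rewrite /e mulrC ler_pdivrMr// mul1r.
have e1 : e <= 1 by rewrite -[e]mulr1; apply: eS; rewrite /S; lra.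
have eN : e * (3 * n + 1) <= rho.
  have : e * ((3 * n + 1) / rho) <= 1 by apply: eS; rewrite /S; lra.
  by rewrite mulrA ler_pdivrMr// mul1r.
have eM : e * (`|M| * n ^+ 2 + n) <= 1 by apply: eS; rewrite /S; lra.
have ne0 : 0 <= n * e by rewrite mulr_ge0// ltW.
move=> x0 [Q [c [g [QQ cc Qc gC chart]]]] x Ox xx0.
have xc i : `|(x - x0) ord0 i| <= e by rewrite (le_trans (coord_le_norm _ _))// ltW.
have cN i : `|c^T ord0 i| <= 1 by rewrite mxE orthonormal_coord_le.
exists c^T; split => // r v /andP[r0 re] vc.
pose w := v - c^T.
have wc i : `|w ord0 i| <= e by rewrite !mxE; have := vc i; rewrite !mxE.
have vQ : v *m Q = w *m Q.
  by rewrite mulmxBl -[c^T *m Q]trmxK trmx_mul trmxK Qc trmx0 subr0.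
have vE : v *m c = 1%:M + w *m c by rewrite mulmxBl cc addrC subrK.
have xrv : x + r *: v - x0 = (x - x0) + r *: v by rewrite addrAC.
have Gx : g ((x - x0) *m Q) < ((x - x0) *m c) ord0 ord0.
  apply/chart => //; apply: le_lt_trans (enorm_le_sum _) _.
  by apply: le_lt_trans (sum_coord_le xc) _; rewrite -/n; lra.
apply/chart.
  apply: le_lt_trans (enorm_le_sum _) _.
  apply: (@le_lt_trans _ _ (n * (3 * e))); last by lra.
  apply: sum_coord_le => i; rewrite xrv mxE [X in _ + X]mxE.
  rewrite (le_trans (ler_normD _ _))// normrM (ger0_norm r0).
  have vi : `|v ord0 i| <= 2.
    rewrite -[v](subrK c^T) mxE (le_trans (ler_normD _ _))//.
    by rewrite -[2]/(1 + 1) lerD// (le_trans (wc i)).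
  have xi := xc i.
  have : r * `|v ord0 i| <= e * 2 by rewrite ler_pM.
  lra.
have := Cl_fun_lipschitz gC ((x - x0) *m Q) ((x + r *: v - x0) *m Q).
have xrvM k (B : 'M[R]_(N, k)) :
    (x - x0 + r *: v) *m B = (x - x0) *m B + r *: (v *m B).
  by rewrite [LHS]mulmxDl scalemxAl.
rewrite xrv !xrvM vQ vE.
set y := (x - x0) *m Q in Gx *; set y' := y + _ => Lg.
rewrite [ltRHS]mxE [X in _ + X]mxE [X in _ + _ * X]mxE.
rewrite [X in _ + _ * (X + _)]mxE eqxx/=.
have wm : `|(w *m c) ord0 ord0| <= n * e.
  by apply: mulmx_coord_le => // i j; rewrite orthonormal_coord_le.
have wQ : \sum_i `|y' ord0 i - y ord0 i| <= n * (r * (n * e)).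
  have h i : `|(y' - y) ord0 i| <= r * (n * e).
    rewrite /y' addrAC subrr add0r mxE normrM (ger0_norm r0) ler_wpM2l//.
    by apply: mulmx_coord_le => // j k; rewrite orthonormal_coord_le.
  rewrite (_ : \sum_i _ = \sum_i `|(y' - y) ord0 i|).
    rewrite (le_trans (sum_coord_le h))// ler_wpM2r ?(mulr_ge0 r0 ne0)//.
    by rewrite /n ler_nat leq_pred.
  by apply: eq_bigr => i _; rewrite [in RHS]mxE [X in _ = `|_ + X|]mxE.
have Mw : M * \sum_i `|y' ord0 i - y ord0 i| <= `|M| * (n * (r * (n * e))).
  rewrite (le_trans (ler_wpM2r _ (ler_norm M)))// ?sumr_ge0//.
  by rewrite ler_wpM2l.
have {}Mw : g y' - g y <= r * (e * (`|M| * n ^+ 2)).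
  rewrite (le_trans (ler_norm _))// (le_trans Lg)// (le_trans Mw)//.
  by rewrite le_eqVlt; apply/orP; left; apply/eqP; ring.
have : r * (e * (`|M| * n ^+ 2 + n)) <= r * 1 by rewrite ler_wpM2l.
have : r * - (n * e) <= r * (w *m c) ord0 ord0.
  by rewrite ler_wpM2l// lerNl (le_trans _ wm)// -normrN ler_norm.
lra.
Qed.

(* A segment from x towards a point outside Om would meet the boundary. *)
Lemma no_boundary_ball (d : R) x : Om x ->
  (forall y, `|y - x| < d -> ~ bdry Om y) -> forall y, `|y - x| < d -> Om y.
Proof.
move=> Ox nb y yd.
pose f (s : R) := x + s *: (y - x).
have cf : continuous f.
  move=> s; apply: cvgD; first exact: cvg_cst.
  exact: scalel_continuous.
have fball s : s \in `[0, 1] -> `|f s - x| < d.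
  rewrite in_itv/= => /andP[s0 s1]; rewrite /f addrAC subrr add0r.
  have -> : `|s *: (y - x)| = `|s| * `|y - x| by rewrite normrZ.
  by rewrite ger0_norm// (le_lt_trans _ yd)// ler_piMl.
(* The parameters mapped into [Om] form a nonempty, relatively open set, which is relatively closed
   because no boundary point is met; connectedness of the interval makes it everything. *)
have : (`[0, 1] `&` f @^-1` Om) = `[0, 1]%classic.
  apply: segment_connected.
  - by exists 0; split; rewrite /= ?in_itv/= ?lexx ?ler01// /f scale0r addr0.
  - exists (f @^-1` Om) => //; apply: open_comp => //.
  - exists (f @^-1` closure Om); first by apply: closed_comp => //; exact: closed_closure.
    apply/seteqP; split=> s /= [s01 Of]; split => //; first exact: subset_closure.
    apply: contrapT => nO; apply: (nb (f s)); first exact: fball.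
    by split => //; move=> /interior_subset.
move=> /(congr1 (fun A : set R => A 1))/=.
have -> : f 1 = y by rewrite /f scale1r addrC subrK.
rewrite in_itv/= ler01 lexx => e.
by have [] : (true /\ Om y) by rewrite e.
Qed.

Hypothesis sOm : Cl_boundary l Om.

(** An unbounded boundary has uniform charts by assumption; a bounded one is compact, and finitely
    many charts give a common aperture. *)
Lemma boundary_has_cone : exists2 d : R, 0 < d &
  forall x0, bdry Om x0 -> forall x, Om x -> `|x - x0| < d -> has_cone d x.
Proof.
case: sOm => chart unif.
have [bb|/unif[rho [M [rho0 ch]]]] := pselect (bounded_set (bdry Om)); last first.
  by have [e e0 eP] := chart_has_cone M rho0; exists e => // x0 /ch; exact: eP.
have cb : compact (bdry Om).
  apply: bounded_closed_compact => //.
  apply: closedI; first exact: closed_closure.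
  exact/open_closedC/open_interior.
pose P (d : R) x0 := forall x, Om x -> `|x - x0| < d -> has_cone d x.
have /compact_near_coveringP/(_ R (0^'+) P _) cov := cb.
have Hd : \forall d \near 0^'+, bdry Om `<=` P d.
  apply: cov => x1 /chart[rho [M [rho0 ch]]].
  have [e e0 /(_ _ ch) eP] := chart_has_cone M rho0.
  (* Half radii: a point within [d] of [x0] is then within [e] of the chart centre [x1]. *)
  exists (ball x1 (e / 2), [set d | d < e / 2]); first split => /=.
  + by apply: nbhsx_ballx; rewrite divr_gt0.
  + by apply: nbhs_right_lt; rewrite divr_gt0.
  move=> [x0 d] /= [x01 de] x Ox xx0; apply: (@has_cone_le e).
    by rewrite ltW// (lt_le_trans de)// ler_pdivrMr// ler_peMr ?ler1n// ltW.
  apply: eP => //; rewrite -(subrK x0 x) -addrA (le_lt_trans (ler_normD _ _))//.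
  rewrite [ltRHS]splitr ltrD//; first exact: lt_trans de.
  by move: x01; rewrite -ball_normE/= -normrN opprB.
have := filterI (nbhs_right_gt (0 : R)) Hd.
by move=> /(_ _)/filter_ex[d [/= d0 dP]]; exists d => // x0 bx0; exact: dP.
Qed.

(** Points near the boundary have the cone just found; around any other point a whole ball lies in
    [Om], and the axis 0 serves. *)
Lemma uniform_has_cone : exists2 e : R, 0 < e & forall x, Om x -> has_cone e x.
Proof.
have [d d0 dP] := boundary_has_cone.
(* The bound [e < 1] makes [r * |v| <= e * e <= e < d] when the axis is 0. *)
pose e := Num.min d 1 / 2.
have m0 : 0 < Num.min d 1 by rewrite lt_min d0 ltr01.
have e0 : 0 < e by rewrite divr_gt0.
have ed : e < d.
  rewrite /e ltr_pdivrMr// (@le_lt_trans _ _ d) ?ge_min ?lexx//.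
  by rewrite ltr_pMr// ltr1n.
have e1 : e < 1.
  rewrite /e ltr_pdivrMr// (@le_lt_trans _ _ 1) ?ge_min ?lexx ?orbT//.
  by rewrite mul1r ltr1n.
exists e => // x Ox.
have [[x0 [bx0 xx0]]|nb] := pselect (exists x0, bdry Om x0 /\ `|x - x0| < d).
  by apply: has_cone_le (dP _ bx0 _ Ox xx0); exact: ltW.
exists 0; split=> [i|r v /andP[r0 re] ve]; first by rewrite mxE normr0.
apply: (@no_boundary_ball d x) => //.
  move=> y yx by_; apply: nb; exists y; split => //.
  by rewrite -normrN opprB.
rewrite addrAC subrr add0r; apply: le_lt_trans ed.
apply/rV_norm_leP => [|j]; first exact: ltW.
have := ve j; rewrite mxE subr0 => vj.
rewrite mxE normrM (ger0_norm r0) -[leRHS]mulr1 ler_pM// (le_trans vj)// ltW //.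
Qed.

End interior_cones.

(** * Lower bounds for L_p norms from superlevel sets *)

Section Lp_lower_bound.
Context {R : realType} d (X : measurableType d).
Variable mu : {measure set X -> \bar R}.
Local Open Scope ereal_scope.

Lemma measure_bigsetU_le (I : Type) (s : seq I) (A : I -> set X) :
  (forall i, measurable (A i)) ->
  mu (\big[setU/set0]_(i <- s) A i) <= \sum_(i <- s) mu (A i).
Proof.
move=> mA; elim: s => [|i s IH]; first by rewrite !big_nil measure0.
rewrite !big_cons (le_trans (measureU2 _ _ _))//.
  by apply: bigsetU_measurable => j _; exact: mA.
exact: leeD.
Qed.

Lemma measurable_superlevel (f : X -> R) (lam : R) : measurable_fun setT f ->
  measurable [set z | (lam < `|f z|)%R].
Proof.
move=> mf.
have mnf : measurable_fun setT (fun z => `|f z|%R) by exact: measurableT_comp.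
have := mnf measurableT `]lam, +oo[%classic (measurable_itv _).
rewrite setTI (_ : _ @^-1` _ = [set z | (lam < `|f z|)%R])//.
by apply/seteqP; split=> z /=; rewrite in_itv/= andbT.
Qed.

Lemma chebyshev_Lnorm (f : X -> R) (p lam : R) : (0 < p)%R -> (0 <= lam)%R ->
  measurable_fun setT f ->
  (lam `^ p)%:E * mu [set z | (lam < `|f z|)%R] <= 'N[mu]_p%:E[EFin \o f] `^ p.
Proof.
move=> p0 lam0 mf; rewrite poweR_Lnorm ?gt_eqF//.
have mnf : measurable_fun setT (fun z => `|f z|%R) by exact: measurableT_comp.
have mE := measurable_superlevel lam mf.
have mfp : measurable_fun setT (fun z => `|(EFin \o f) z| `^ p).
  by apply/measurable_EFinP; apply: (measurableT_comp (measurable_powR _) mnf).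
rewrite -integral_cst//.
apply: (@le_trans _ _ (\int[mu]_(x in [set z | (lam < `|f z|)%R])
    (`|(EFin \o f) x| `^ p))).
  apply: ge0_le_integral => //.
  - by move=> z _; rewrite lee_fin powR_ge0.
  - exact: measurable_funTS.
  - by move=> z /= lz; rewrite lee_fin ge0_ler_powR ?nnegrE// ltW.
by apply: ge0_subset_integral => // z _; exact: poweR_ge0.
Qed.

(** The preimages under the maps [Phi i] of the superlevel set [E] cover [B], and none is larger
    than [E]. Hence [mu B <= #|I| * mu E], and Chebyshev's inequality finishes. *)
Lemma Lnorm_lower_bound (I : finType) (Phi : I -> X -> X) (f : X -> R)
    (p lam : R) (B : set X) : (0 < p)%R -> (0 <= lam)%R ->
  measurable_fun setT f ->
  (forall i, measurable_fun setT (Phi i)) ->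
  (forall i E, measurable E -> mu (Phi i @^-1` E) <= mu E) ->
  measurable B ->
  (forall z, B z -> exists i, (lam < `|f (Phi i z)|)%R) ->
  (lam `^ p)%:E * mu B <= #|I|%:R%:E * 'N[mu]_p%:E[EFin \o f] `^ p.
Proof.
move=> p0 lam0 mf mPhi muPhi mB BE.
set E := [set z | (lam < `|f z|)%R].
have mE : measurable E by exact: measurable_superlevel.
have mPE i : measurable (Phi i @^-1` E).
  by rewrite -[X in measurable X]setTI; exact: mPhi.
have BU : B `<=` \big[setU/set0]_(i <- index_enum I) (Phi i @^-1` E).
  by move=> z /BE[i zi]; rewrite -bigcup_seq; exists i => //=; exact: mem_index_enum.
have muB : mu B <= #|I|%:R%:E * mu E.
  apply: (@le_trans _ _
    (mu (\big[setU/set0]_(i <- index_enum I) (Phi i @^-1` E)))).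
    apply: le_measure; rewrite ?inE//; exact: bigsetU_measurable.
  apply: (le_trans (measure_bigsetU_le _ _)) => //.
  rewrite (@le_trans _ _ (\sum_(i in I) mu E))//.
    by rewrite big_mkcond/=; apply: lee_sum => i _; exact: muPhi.
  by rewrite sumr_const mule_natl cardT.
apply: (@le_trans _ _ ((lam `^ p)%:E * (#|I|%:R%:E * mu E))).
  by rewrite lee_wpmul2l// lee_fin powR_ge0.
by rewrite muleCA lee_wpmul2l ?lee_fin//; exact: chebyshev_Lnorm.
Qed.

End Lp_lower_bound.

(** * Solving the measure inequality for the pointwise value *)

Section interpolation_algebra.
Context {R : realType}.

(** Collecting the powers of [mu] gives the exponent [p + D / l] on the left; raising both sides to
    the power [l / (l * p + D)] isolates [mu]. The dimension [D] is [N] on a time slice and [N + 2]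
    in space-time. *)
Lemma interpolation_bound (D l p kap eps mu K V : R) :
  0 <= D -> 0 < l -> 0 < p -> 0 < kap -> 0 < eps -> 0 < mu -> 0 < K -> 0 <= V ->
  kap * mu `^ p * (eps * (mu / K) `^ l^-1) `^ D <= V `^ p ->
  mu <= (kap * eps `^ D) `^ (- (l / (l * p + D))) *
    K `^ (D / (l * p + D)) * V `^ (1 - D / (l * p + D)).
Proof.
move=> D0 l0 p0 kap0 eps0 mu0 K0 V0 h.
have lp0 : 0 < l * p by rewrite mulr_gt0.
have q0 : 0 < l * p + D by lra.
set c := kap * eps `^ D; have c0 : 0 < c by rewrite mulr_gt0// powR_gt0.
have h1 : c * mu `^ ((l * p + D) / l) <= K `^ (D / l) * V `^ p.
  rewrite -ler_pdivrMl ?powR_gt0//; apply: le_trans h.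
  have hK : (mu / K) `^ (l^-1 * D) = mu `^ (l^-1 * D) * (K `^ (D / l))^-1.
    rewrite powRM ?invr_ge0 ?ltW// -[K^-1]powR_inv1 ?ltW// -powRrM -powRN.
    by congr (_ * _ `^ _); field; rewrite gt_eqF.
  rewrite (powRM _ (ltW eps0)) ?powR_ge0// -powRrM hK.
  have -> : (l * p + D) / l = p + l^-1 * D by field; rewrite gt_eqF.
  rewrite powRD; last by rewrite (gt_eqF mu0) implybT.
  rewrite le_eqVlt; apply/orP; left; apply/eqP.
  by rewrite /c; ring.
have e0 : 0 <= l / (l * p + D) by rewrite divr_ge0 ?ltW.
have h2 : mu `^ ((l * p + D) / l) <= c^-1 * (K `^ (D / l) * V `^ p).
  by rewrite ler_pdivlMl.
have := ge0_ler_powR e0 _ _ h2.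
rewrite !nnegrE powR_ge0 !mulr_ge0 ?invr_ge0 ?powR_ge0 ?(ltW c0)// => /(_ isT isT).
rewrite -powRrM (_ : (l * p + D) / l * (l / (l * p + D)) = 1); last first.
  by field; rewrite !gt_eqF.
rewrite powRr1 ?(ltW mu0)// => /le_trans -> //.
have KV0 : 0 <= K `^ (D / l) * V `^ p by rewrite mulr_ge0 ?powR_ge0.
have ci0 : 0 <= c^-1 by rewrite invr_ge0 ltW.
rewrite (powRM _ ci0 KV0) (powRM _ (powR_ge0 K _) (powR_ge0 V _)) -!powRrM.
rewrite -[c^-1]powR_inv1 ?(ltW c0)// -powRrM mulN1r mulrA.
rewrite (_ : D / l * (l / (l * p + D)) = D / (l * p + D)); last first.
  by field; rewrite !gt_eqF.
rewrite (_ : p * (l / (l * p + D)) = 1 - D / (l * p + D)) //.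
by field; rewrite !gt_eqF.
Qed.

End interpolation_algebra.

(** * Interpolation *)

Section interpolation.
Context {R : realType} {N : nat}.
Variables (Om : set 'rV[R]_N) (T l p e : R).
Hypotheses (N_gt0 : (0 < N)%N) (T_gt0 : 0 < T) (l_gt0 : 0 < l) (p_gt0 : 0 < p)
  (e_gt0 : 0 < e) (oOm : open Om) (Om0 : Om !=set0)
  (cone : forall x, Om x -> has_cone Om e x).
(** [n1] and [n2] are the orders of the spatial and temporal differences; [G * rho] bounds the sum
    of the absolute coordinates of a spatial step of scale [rho]. *)
Let n1 := (Num.truncn l).+1.
Let n2 := ((Num.truncn l)./2).+1.
Let G := N%:R * (1 + e).
Implicit Types (nu h x : 'rV[R]_N) (rho t tau s lam : R).

(** Continuity up to the boundary reduces the closed cylinder to the open one. *)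
Lemma max_norm_le (u : 'rV[R]_N * R -> R) (b : R) :
  {within ccyl Om T, continuous u} -> (forall z, cyl Om T z -> `|u z| <= b) ->
  (max_norm Om T u <= b%:E)%E.
Proof.
move=> uc ub; apply: ge_ereal_sup => _ [z cz <-]; rewrite lee_fin.
apply/ler_addgt0Pr => d d0.
have /subspace_continuousP/(_ z cz)/cvgrPdist_le/(_ d d0) uz := uc.
case: z cz uz => x t [/= Ox tT] [[A B] /= [xA tB] AB].
have [x' [Ox' Ax']] := Ox A xA.
have [t' [t'T Bt']] : exists t', (0 < t' < T) /\ B t'.
  move/nbhs_ballP: tB => [r /= r0 rB].
  (* Pulling [t] towards [T / 2] by the fraction [s < 1] lands strictly inside the interval, and
     [s * T < r] keeps the displacement below [r]. *)
  pose s := r / (r + T).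
  have s0 : 0 < s by rewrite divr_gt0// addr_gt0.
  have s1 : s < 1 by rewrite ltr_pdivrMr ?addr_gt0// mul1r ltrDl.
  have sT : s * T < r.
    by rewrite mulrAC ltr_pdivrMr ?addr_gt0// mulrDr ltrDr mulr_gt0.
  move: tT; rewrite in_itv/= => /andP[t0 tT].
  have sT0 : 0 < s * T by rewrite mulr_gt0.
  have st0 : 0 <= s * t by rewrite mulr_ge0// ltW.
  have stT : s * t <= s * T by rewrite ler_wpM2l// ltW.
  have st1 : s * t <= t by rewrite ler_piMl// ltW.
  have sTt : 0 <= (1 - s) * (T - t) by rewrite mulr_ge0// subr_ge0// ltW.
  exists (t + s * (T / 2 - t)); split.
    by apply/andP; split; lra.
  by apply: rB; rewrite -ball_normE/= ltr_distlC; apply/andP; split; lra.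
have Cz' : cyl Om T (x', t') by split; rewrite /= ?in_itv.
have := AB (x', t') (conj Ax' Bt') (cyl_sub_ccyl Cz') => /= h.
rewrite -[u (x, t)](subrK (u (x', t'))) (le_trans (ler_normD _ _))// addrC.
by rewrite lerD// ub.
Qed.

(** The spatial steps [h = rho *: v] with [v] strictly within [e] of the cone axis in every
    coordinate: a cube of side [2 * e * rho]. *)
Definition box (nu : 'rV[R]_N) (rho : R) : set 'rV[R]_N :=
  [set h | forall i,
    `]rho * (nu ord0 i - e), rho * (nu ord0 i + e)[%classic (h ord0 i)].

Lemma lebesgue_box nu rho : 0 < rho ->
  lebesgue_rV (box nu rho) = ((rho * (2 * e)) ^+ N)%:E.
Proof.
move=> rho0.
pose I i := `]rho * (nu ord0 i - e), rho * (nu ord0 i + e)[%classic.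
have mI i : measurable (I i : set (measurableTypeR R)) by exact: measurable_itv.
rewrite (lebesgue_rV_box mI) (eq_bigr (fun=> (rho * (2 * e))%:E)).
  by rewrite prodEFin prodr_const card_ord.
have ee : - e < e by rewrite (@lt_trans _ _ 0) ?oppr_lt0.
move=> i _; rewrite lebesgue_measure_itv/= lte_fin ltr_pM2l// ltrD2l ee.
by rewrite -EFinB; congr EFin; ring.
Qed.

Lemma measurable_box nu rho : measurable (box nu rho).
Proof.
rewrite (_ : box nu rho = \big[setI/setT]_(i <- index_enum 'I_N)
    ((fun v : 'rV[R]_N => v ord0 i) @^-1`
      `]rho * (nu ord0 i - e), rho * (nu ord0 i + e)[%classic)).
  apply: bigsetI_measurable => i _; rewrite -[X in measurable X]setTI.
  by apply: (@measurable_coord_rV R N i) => //; exact: measurable_itv.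
rewrite -bigcap_seq; apply/seteqP; split=> [v Bv i _|v Bv i]; first exact: Bv.
by apply: Bv; rewrite /= mem_index_enum.
Qed.

Lemma box_coord nu rho h : 0 < rho -> box nu rho h ->
  forall i, `|(rho^-1 *: h) ord0 i - nu ord0 i| <= e.
Proof.
move=> rho0 hB i; have := hB i; rewrite /= in_itv/= => /andP[h1 h2].
rewrite mxE mulrC ler_distl ler_pdivlMr// ler_pdivrMr// mulrC [_ * rho]mulrC.
by rewrite !ltW.
Qed.

Lemma box_segment x nu rho h s : 0 < rho -> n1%:R * rho <= e -> box nu rho h ->
  (forall (r : R) (v : 'rV[R]_N), 0 <= r <= e ->
    (forall i, `|v ord0 i - nu ord0 i| <= e) -> Om (x + r *: v)) ->
  0 <= s <= n1%:R -> Om (x + s *: h).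
Proof.
move=> rho0 n1rho hB nuP /andP[s0 sn].
have -> : s *: h = (s * rho) *: (rho^-1 *: h).
  by rewrite scalerA mulfK ?gt_eqF.
apply: nuP; last exact: box_coord.
by rewrite mulr_ge0 ?(ltW rho0)//= (le_trans _ n1rho)// ler_wpM2r// ltW.
Qed.

Lemma box_sum nu rho h : 0 < rho -> (forall i, `|nu ord0 i| <= 1) ->
  box nu rho h -> \sum_i `|h ord0 i| <= G * rho.
Proof.
move=> rho0 nu1 hB; rewrite -mulrA; apply: sum_coord_le => i.
have -> : h ord0 i = rho * ((rho^-1 *: h) ord0 i).
  by rewrite mxE mulrA divff ?mul1r ?gt_eqF.
rewrite normrM (gtr0_norm rho0) mulrC ler_wpM2r ?(ltW rho0)//.
rewrite -(subrK (nu ord0 i) ((rho^-1 *: h) ord0 i)).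
rewrite (le_trans (ler_normD _ _))//.
by rewrite addrC lerD// box_coord.
Qed.

(* Time steps point into the longer of [0, t] and [t, T]. *)
Lemma time_interval (t tau0 : R) : 0 < t < T -> 0 < tau0 ->
  n2%:R * tau0 <= T / 2 ->
  exists a, forall tau, tau \in `]a, a + tau0[ ->
    [/\ tau != 0, `|tau| <= tau0 &
        forall s, 0 <= s <= n2%:R -> 0 < t + s * tau < T].
Proof.
move=> /andP[t0 tT] tau00 n2tau.
have [th|th] := leP t (T / 2).
  exists 0 => tau; rewrite in_itv/= add0r => /andP[tau_gt0 tau_lt].
  split; first by rewrite gt_eqF.
    by rewrite gtr0_norm// ltW.
  move=> s /andP[s0 sn].
  have st : 0 <= s * tau by rewrite mulr_ge0// ltW.
  have : s * tau < n2%:R * tau0.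
    rewrite (@le_lt_trans _ _ (n2%:R * tau))//; first by rewrite ler_wpM2r// ltW.
    by rewrite ltr_pM2l.
  move=> h; apply/andP; split; lra.
exists (- tau0) => tau; rewrite in_itv/= addNr => /andP[tau_gt tau_lt0].
split; first by rewrite lt_eqF.
  by rewrite ltr0_norm// lerNl ltW.
move=> s /andP[s0 sn].
have st : s * tau <= 0 by rewrite mulr_ge0_le0// ltW.
have : n2%:R * - tau0 < s * tau.
  rewrite (@lt_le_trans _ _ (n2%:R * tau))//; first by rewrite ltr_pM2l.
  by rewrite ler_wnM2r// ltW.
move=> h; apply/andP; split; lra.
Qed.

Section one_function.
Variable u : 'rV[R]_N * R -> R.
Hypothesis hu : holder_space Om T l u.
Let K := fine (holder_norm Om T l u).

Lemma holder_norm_ge0 : 0 <= K.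
Proof.
have [z Cz] := cyl_nonempty T_gt0 Om0.
exact: le_trans (abs_le_holder N_gt0 T_gt0 oOm Om0 hu Cz).
Qed.

Lemma space_box_estimate x t nu rho h lam : 0 < t < T -> 0 <= lam ->
  0 < rho -> (forall i, `|nu ord0 i| <= 1) -> box nu rho h ->
  (forall s, 0 <= s <= n1%:R -> Om (x + s *: h)) ->
  (forall k, (0 < k <= n1)%N -> `|u (x + k%:R *: h, t)| <= lam) ->
  `|u (x, t)| <= 2 ^+ n1 * lam + G `^ l * (K * rho `^ l).
Proof.
move=> tT lam0 rho0 nu1 hB Oh uh.
apply: (le_trans (space_difference_estimate N_gt0 T_gt0 oOm Om0 hu tT lam0 Oh uh)).
rewrite lerD2l mulrCA [leRHS]mulrCA ler_wpM2l ?holder_norm_ge0//.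
have G0 : 0 < G by rewrite mulr_gt0 ?ltr0n// addr_gt0.
have S0 : 0 <= \sum_i `|h ord0 i| by rewrite sumr_ge0.
have SG := box_sum rho0 nu1 hB.
have a0 : 0 <= l - (Num.truncn l)%:R by rewrite subr_ge0 truncn_le// ltW.
rewrite -powRM ?(ltW G0) ?(ltW rho0)//.
rewrite (_ : (G * rho) `^ l =
    (G * rho) ^+ Num.truncn l * (G * rho) `^ (l - (Num.truncn l)%:R)).
  rewrite ler_pM ?exprn_ge0 ?powR_ge0//.
    by rewrite lerXn2r// nnegrE// ltW// mulr_gt0.
  rewrite ge0_ler_powR// ?nnegrE ?sqrtr_ge0//; first by rewrite ltW// mulr_gt0.
  exact: le_trans (enorm_le_sum _) SG.
have Gr : 0 < G * rho by rewrite mulr_gt0.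
rewrite -powR_mulrn ?(ltW Gr)// -powRD; last by rewrite (gt_eqF Gr) implybT.
by rewrite addrC subrK.
Qed.

Lemma exists_large_space x t nu rho h lam : Om x -> 0 < t < T -> 0 <= lam ->
  0 < rho -> n1%:R * rho <= e -> (forall i, `|nu ord0 i| <= 1) ->
  (forall (r : R) (v : 'rV[R]_N), 0 <= r <= e ->
    (forall i, `|v ord0 i - nu ord0 i| <= e) -> Om (x + r *: v)) ->
  box nu rho h ->
  2 ^+ n1 * lam + G `^ l * (K * rho `^ l) < `|u (x, t)| ->
  exists k : 'I_n1, lam < `|(u \_ (cyl Om T)) (x + k.+1%:R *: h, t)|.
Proof.
move=> Ox tT lam0 rho0 n1rho nu1 nuP hB; apply: contraPP => nex.
apply/negP; rewrite -leNgt.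
have Oh s : 0 <= s <= n1%:R -> Om (x + s *: h).
  exact: (box_segment rho0 n1rho hB nuP).
apply: (space_box_estimate _ _ _ nu1 hB) => // k /andP[k0 kn].
rewrite leNgt; apply/negP => uk; apply: nex.
have kn' : (k.-1 < n1)%N by rewrite prednK.
exists (Ordinal kn'); rewrite /= prednK// patchT// inE; split=> /=.
  by apply: Oh; rewrite ler0n ler_nat.
by rewrite in_itv.
Qed.

(** Two stages: the spatial differences first find a large value at some node [x + k.+1 *: h] at
    time [t], then the temporal differences from that node find one at a later multiple of [tau].
    Since [|tau| <= rho ^+ 2], the temporal error is also at most [K * rho ^ l]. *)
Lemma exists_large_spacetime x t nu rho h tau lam : Om x -> 0 < t < T ->
  0 <= lam -> 0 < rho -> n1%:R * rho <= e -> (forall i, `|nu ord0 i| <= 1) ->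
  (forall (r : R) (v : 'rV[R]_N), 0 <= r <= e ->
    (forall i, `|v ord0 i - nu ord0 i| <= e) -> Om (x + r *: v)) ->
  box nu rho h ->
  tau != 0 -> `|tau| <= rho ^+ 2 ->
  (forall s, 0 <= s <= n2%:R -> 0 < t + s * tau < T) ->
  2 ^+ n1 * (2 ^+ n2 * lam + K * rho `^ l) + G `^ l * (K * rho `^ l)
    < `|u (x, t)| ->
  exists ki : 'I_n1 * 'I_n2, lam <
    `|(u \_ (cyl Om T)) (x + ki.1.+1%:R *: h, t + ki.2.+1%:R * tau)|.
Proof.
move=> Ox tT lam0 rho0 n1rho nu1 nuP hB tau0 taur tauT big.
have lam'0 : 0 <= 2 ^+ n2 * lam + K * rho `^ l.
  by rewrite addr_ge0// mulr_ge0 ?exprn_ge0 ?holder_norm_ge0 ?powR_ge0.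
have Oh s : 0 <= s <= n1%:R -> Om (x + s *: h).
  exact: (box_segment rho0 n1rho hB nuP).
have [k uk] := exists_large_space Ox tT lam'0 rho0 n1rho nu1 nuP hB big.
have Ok : Om (x + k.+1%:R *: h) by apply: Oh; rewrite ler0n ler_nat ltn_ord.
move: uk; rewrite patchT; last by rewrite inE; split => //=; rewrite in_itv.
apply: contraPP => nex; apply/negP; rewrite -leNgt.
have := time_difference_estimate N_gt0 T_gt0 oOm Om0 hu Ok lam0 tau0 tauT.
move=> /(_ _)/le_trans; apply.
  move=> i /andP[i0 inn]; rewrite leNgt; apply/negP => ui; apply: nex.
  have in' : (i.-1 < n2)%N by rewrite prednK.
  exists (k, Ordinal in'); rewrite /= prednK// patchT// inE; split=> //=.
  by rewrite in_itv/=; apply: tauT; rewrite ler0n ler_nat.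
rewrite lerD2l ler_wpM2l ?holder_norm_ge0//.
have -> : rho `^ l = (rho ^+ 2) `^ (l / 2).
  by rewrite -powR_mulrn ?(ltW rho0)// -powRrM mulrC divfK.
apply: ge0_ler_powR => //; first by rewrite divr_ge0// ltW.
by rewrite nnegrE exprn_ge0// ltW.
Qed.

End one_function.

(** The first two upper bounds on [eps] keep the nodes in the cone and in the time interval; the
    last makes the total difference error at most a quarter of [mu]. *)
Lemma exists_small_scale (B : R) : 0 < B -> exists eps : R,
  [/\ 0 < eps, n1%:R * eps <= e, n2%:R * eps ^+ 2 <= T / 2 &
      B * eps `^ l <= 4^-1].
Proof.
move=> B0.
pose c := ((4 * B)^-1) `^ l^-1.
have c0 : 0 < c by rewrite powR_gt0// invr_gt0 mulr_gt0.
(* The entry 1 in the minimum gives [eps ^+ 2 <= eps], which turns the third entry into the bound on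
   the time steps. *)
pose eps := Num.min (Num.min (e / n1%:R) 1) (Num.min (T / 2 / n2%:R) c).
have eps0 : 0 < eps by rewrite !lt_min !divr_gt0 ?ltr01 ?ltr0n.
have [h1 h2 h3 h4] :
    [/\ eps <= e / n1%:R, eps <= 1, eps <= T / 2 / n2%:R & eps <= c].
  by split; rewrite /eps !ge_min lexx ?orbT.
exists eps; split => //.
- by rewrite mulrC -ler_pdivlMr ?ltr0n.
- rewrite mulrC -ler_pdivlMr ?ltr0n// (le_trans _ h3)// expr2 ler_piMl//.
  exact: ltW.
- have : eps `^ l <= c `^ l.
    apply: ge0_ler_powR => //; first exact: ltW.
      by rewrite nnegrE ltW.
    by rewrite nnegrE ltW.
  rewrite /c -powRrM mulVf ?gt_eqF// powRr1; last by rewrite invr_ge0 ltW// mulr_gt0.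
  rewrite -(ler_pM2l B0) => /le_trans; apply.
  by rewrite le_eqVlt; apply/orP; left; apply/eqP; field; rewrite gt_eqF.
Qed.

(** The scale balances the Hoelder error [K * rho ^ l] against [mu]; [mu <= K] ensures that it does
    not exceed [eps]. *)
Lemma scale_properties (mu K eps : R) : 0 < mu <= K -> 0 < eps ->
  let rho := eps * (mu / K) `^ l^-1 in
  [/\ 0 < rho, rho <= eps & K * rho `^ l = eps `^ l * mu].
Proof.
move=> /andP[mu0 muK] eps0 rho; have K0 := lt_le_trans mu0 muK.
have q0 : 0 < mu / K by rewrite divr_gt0.
split; first by rewrite mulr_gt0// powR_gt0.
  rewrite /rho ler_piMr ?(ltW eps0)//.
  have e1 : 1 = 1 `^ l^-1 :> R by rewrite powR1.
  rewrite [leRHS]e1; apply: ge0_ler_powR;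
    rewrite ?nnegrE ?invr_ge0 ?(ltW l_gt0) ?(ltW q0)//.
  by rewrite ler_pdivrMr// mul1r.
rewrite /rho powRM ?(ltW eps0) ?powR_ge0// -powRrM mulVf ?gt_eqF//.
by rewrite powRr1 ?(ltW q0)//; field; rewrite gt_eqF.
Qed.

Lemma pointwise_interpolation_space : exists C : R, 0 < C /\
  forall u, holder_space Om T l u -> Lp_space_cyl p Om T u ->
  forall x t V, Om x -> 0 < t < T -> 0 <= V ->
    (Lp_norm p Om (fun y => u (y, t)) <= V%:E)%E ->
    `|u (x, t)| <= C * fine (holder_norm Om T l u) `^ (N%:R / (l * p + N%:R)) *
      V `^ (1 - N%:R / (l * p + N%:R)).
Proof.
have G0 : 0 < G by rewrite mulr_gt0 ?ltr0n// addr_gt0.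
have [eps [eps0 epse _ epsl]] := exists_small_scale (powR_gt0 l G0).
(* Three sources: the level [lam / mu] to the power [p], the volume of the cube at [rho = 1], and
   the number [n1] of nodes. *)
pose kap := (2^-1 ^+ n1.+1) `^ p * (2 * e) ^+ N / n1%:R.
have kap0 : 0 < kap.
  by rewrite divr_gt0 ?ltr0n// mulr_gt0 ?exprn_gt0 ?mulr_gt0// powR_gt0//
    exprn_gt0 ?invr_gt0.
exists ((kap * eps `^ N%:R) `^ (- (l / (l * p + N%:R)))); split.
  by rewrite powR_gt0// mulr_gt0// powR_gt0.
move=> u hu Lu x t V Ox tT V0 LV.
set K := fine _; set mu := `|u (x, t)|.
have Cz : cyl Om T (x, t) by split; rewrite //= in_itv.
have muK : mu <= K := abs_le_holder N_gt0 T_gt0 oOm Om0 hu Cz.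
have [->|mu_neq0] := eqVneq mu 0; first by rewrite !mulr_ge0 ?powR_ge0.
have mu0 : 0 < mu by rewrite lt_neqAle eq_sym mu_neq0 normr_ge0.
have K0 : 0 < K := lt_le_trans mu0 muK.
have mu0K : 0 < mu <= K by rewrite mu0.
have [] := scale_properties mu0K eps0; set rho := eps * _ => rho0 rhoe Krho.
apply: interpolation_bound => //; rewrite -/rho.
have n1rho : n1%:R * rho <= e by rewrite (le_trans _ epse)// ler_wpM2l.
(* Chosen so that [2 ^+ n1 * lam = mu / 2]; adding the error of at most [mu / 4] stays strictly
   below [mu]. *)
pose lam := mu * 2^-1 ^+ n1.+1.
have lam0 : 0 <= lam by rewrite mulr_ge0 ?(ltW mu0)// exprn_ge0 ?invr_ge0.
have big : 2 ^+ n1 * lam + G `^ l * (K * rho `^ l) < mu.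
  have -> : 2 ^+ n1 * lam = mu / 2.
    have half : 2 ^+ n1 * 2^-1 ^+ n1 = 1 :> R by rewrite -exprMn divff// expr1n.
    by rewrite /lam [2^-1 ^+ _]exprS mulrCA (mulrCA (2 ^+ n1)) half mulr1.
  have : G `^ l * (K * rho `^ l) <= 4^-1 * mu.
    by rewrite Krho mulrA ler_wpM2r// ltW.
  lra.
have [nu [nu1 nuP]] := cone Ox.
(* Membership in L_p gives measurability in space-time of the extension by zero; its sections at
   fixed [t] are then measurable. *)
have sliceE : (fun y => (u \_ (cyl Om T)) (y, t)) = (fun y => u (y, t)) \_ Om.
  apply/funext => y; rewrite /patch.
  suff -> : ((y, t) \in cyl Om T) = (y \in Om) by [].
  apply/idP/idP; rewrite !inE; first by case.
  by move=> Oy; split; rewrite //= in_itv.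
have mslice : measurable_fun setT ((fun y => u (y, t)) \_ Om).
  rewrite -sliceE; apply: measurable_fun_pair1.
  by have /sub_Lfun_mfun := Lu; rewrite inE.
have L : ((lam `^ p)%:E * lebesgue_rV (box nu rho) <=
    #|'I_n1|%:R%:E * Lp_norm p Om (fun y => u (y, t)) `^ p)%E.
  apply: (Lnorm_lower_bound (Phi := fun (k : 'I_n1) h => x + k.+1%:R *: h)) => //.
  - by move=> k; exact: measurable_dilation_rV.
  (* The node index starts at 1, so each map dilates by a factor at least 1 and preimages do not
     gain measure. *)
  - move=> k E mE; rewrite [leRHS](lebesgue_rV_dilation x (k := k.+1%:R))//.
    by rewrite -[leLHS]mul1e lee_wpmul2r// lee_fin exprn_ege1// ler1n.
  - exact: measurable_box.
  - move=> h hB; rewrite -sliceE.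
    exact: (exists_large_space hu Ox tT lam0
      rho0 n1rho nu1 nuP hB big).
rewrite lebesgue_box// card_ord in L.
have {}L : lam `^ p * (rho * (2 * e)) ^+ N <= n1%:R * V `^ p.
  rewrite -lee_fin EFinM (le_trans L)// EFinM lee_wpmul2l ?lee_fin//.
  rewrite -poweR_EFin; apply: (gt0_ler_poweR (ltW p_gt0)) => //; rewrite in_itv/=.
    by rewrite leey andbT Lnorm_ge0.
  by rewrite lee_fin V0 leey.
rewrite -(ler_pM2l (x := n1%:R)) ?ltr0n//; apply: le_trans L.
have q0 : 0 <= 2^-1 ^+ n1.+1 :> R by rewrite exprn_ge0 ?invr_ge0.
rewrite powR_mulrn ?(ltW rho0)// /lam /kap (powRM _ (ltW mu0) q0).
rewrite (exprMn _ rho) le_eqVlt; apply/orP; left; apply/eqP.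
move: (rho ^+ N) ((2 * e) ^+ N) (mu `^ p) ((_ ^+ _) `^ p) => a b c d.
by field; rewrite pnatr_eq0.
Qed.

Lemma pointwise_interpolation_spacetime : exists C : R, 0 < C /\
  forall u, holder_space Om T l u -> Lp_space_cyl p Om T u ->
  forall x t V, Om x -> 0 < t < T -> 0 <= V -> Lp_norm_cyl p Om T u = V%:E ->
    `|u (x, t)| <= C *
      fine (holder_norm Om T l u) `^ ((N%:R + 2) / (l * p + (N%:R + 2))) *
      V `^ (1 - (N%:R + 2) / (l * p + (N%:R + 2))).
Proof.
have G0 : 0 < G by rewrite mulr_gt0 ?ltr0n// addr_gt0.
have B0 : 0 < 2 ^+ n1 + G `^ l by rewrite addr_gt0 ?exprn_gt0 ?powR_gt0.
have [eps [eps0 epse epsT epsl]] := exists_small_scale B0.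
(* As on a slice, with [n1 * n2] nodes; the time interval has length exactly [rho ^+ 2] and adds no
   constant. *)
pose kap := (2^-1 ^+ (n1 + n2).+1) `^ p * (2 * e) ^+ N / (n1 * n2)%:R.
have n12 : 0 < (n1 * n2)%:R :> R by rewrite ltr0n muln_gt0.
have kap0 : 0 < kap.
  by rewrite divr_gt0// mulr_gt0 ?exprn_gt0 ?mulr_gt0// powR_gt0//
    exprn_gt0 ?invr_gt0.
have D0 : 0 < N%:R + 2 :> R by rewrite ltr_wpDl.
exists ((kap * eps `^ (N%:R + 2)) `^ (- (l / (l * p + (N%:R + 2))))); split.
  by rewrite powR_gt0// mulr_gt0// powR_gt0.
move=> u hu Lu x t V Ox tT V0 LV.
set K := fine _; set mu := `|u (x, t)|.
have Cz : cyl Om T (x, t) by split; rewrite //= in_itv.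
have muK : mu <= K := abs_le_holder N_gt0 T_gt0 oOm Om0 hu Cz.
have [->|mu_neq0] := eqVneq mu 0; first by rewrite !mulr_ge0 ?powR_ge0.
have mu0 : 0 < mu by rewrite lt_neqAle eq_sym mu_neq0 normr_ge0.
have K0 : 0 < K := lt_le_trans mu0 muK.
have mu0K : 0 < mu <= K by rewrite mu0.
have [] := scale_properties mu0K eps0; set rho := eps * _ => rho0 rhoe Krho.
apply: interpolation_bound => //; rewrite -/rho.
have n1rho : n1%:R * rho <= e by rewrite (le_trans _ epse)// ler_wpM2l.
have rho20 : 0 < rho ^+ 2 by rewrite exprn_gt0.
have n2rho : n2%:R * rho ^+ 2 <= T / 2.
  by rewrite (le_trans _ epsT)// ler_wpM2l// lerXn2r ?nnegrE ?(ltW rho0) ?(ltW eps0).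
(* The two stages lose a factor [2 ^+ (n1 + n2)], so the nodes again account for [mu / 2]. *)
pose lam := mu * 2^-1 ^+ (n1 + n2).+1.
have lam0 : 0 <= lam by rewrite mulr_ge0 ?(ltW mu0)// exprn_ge0 ?invr_ge0.
have big : 2 ^+ n1 * (2 ^+ n2 * lam + K * rho `^ l) +
    G `^ l * (K * rho `^ l) < mu.
  have half : 2 ^+ (n1 + n2) * 2^-1 ^+ (n1 + n2) = 1 :> R.
    by rewrite -exprMn divff// expr1n.
  have l2 : 2 ^+ n1 * (2 ^+ n2 * lam) = mu / 2.
    rewrite mulrA -exprD /lam [2^-1 ^+ _]exprS mulrCA.
    by rewrite (mulrCA (2 ^+ (n1 + n2))) half mulr1.
  have : (2 ^+ n1 + G `^ l) * (K * rho `^ l) <= 4^-1 * mu.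
    by rewrite Krho mulrA ler_wpM2r// ltW.
  rewrite mulrDr l2 mulrDl; lra.
have [nu [nu1 nuP]] := cone Ox.
have [a aP] := time_interval tT rho20 n2rho.
have mf : measurable_fun setT (u \_ (cyl Om T)).
  by have /sub_Lfun_mfun := Lu; rewrite inE.
pose S : set (measurableTypeR R) := `]a, a + rho ^+ 2[%classic.
have L : ((lam `^ p)%:E * lebesgue_xt (box nu rho `*` S) <=
    #|{: 'I_n1 * 'I_n2}|%:R%:E * Lp_norm_cyl p Om T u `^ p)%E.
  pose Phi (ki : 'I_n1 * 'I_n2) (z : 'rV[R]_N * measurableTypeR R) :
      'rV[R]_N * measurableTypeR R :=
    (x + ki.1.+1%:R *: z.1, t + ki.2.+1%:R * z.2).
  apply: (@Lnorm_lower_bound R _ _ (@lebesgue_xt R N) _ Phi) => //.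
  - move=> [k i] /=; apply: measurable_fun_pair.
      exact: (measurableT_comp (measurable_dilation_rV _ _) measurable_fst).
    by apply: measurable_funD => //; exact: measurable_funM.
  - move=> [k i] E mE /=.
    have c1 : 0 <= (k.+1%:R ^+ N : R) by rewrite exprn_ge0.
    have c2 : 0 <= (i.+1%:R : R) by [].
    have mt : measurable_fun setT ((fun s => t + i.+1%:R * s) :
        measurableTypeR R -> measurableTypeR R).
      by apply: measurable_funD => //; exact: measurable_funM.
    have := @product_measure_dilation R _ _ _ _ (@lebesgue_rV R N) (@lebesgue_measure R)
      (fun h => x + k.+1%:R *: h) (fun s => t + i.+1%:R * s) _ _ c1 c2
      (measurable_dilation_rV _ _) mt _ _ E mE.
    move=> /(_ _ _)/(congr1 (fun r : \bar R => (_ <= r)%E)) -> //.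
    + rewrite -[leLHS]mul1e lee_wpmul2r// lee_fin.
      by rewrite mulr_ege1 ?exprn_ege1 ?ler1n.
    + by move=> A mA; apply: lebesgue_rV_dilation.
    + by move=> A mA; apply: lebesgue_measure_dilation.
  - by apply: measurableX; [exact: measurable_box|exact: measurable_itv].
  - move=> [h tau] [/= hB tauS]; have [tau_neq0 tau_le tauT] := aP _ tauS.
    exact: (exists_large_spacetime hu Ox tT lam0
      rho0 n1rho nu1 nuP hB tau_neq0 tau_le tauT big).
have BS : lebesgue_xt (box nu rho `*` S) = ((rho * (2 * e)) ^+ N * rho ^+ 2)%:E.
  transitivity (lebesgue_rV (box nu rho) * lebesgue_measure S)%E.
    by apply: product_measure1E; [exact: measurable_box|exact: measurable_itv].
  rewrite lebesgue_box// /S lebesgue_measure_itv/= lte_fin ltrDl rho20.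
  by rewrite -EFinB -EFinM; congr (_ * _)%:E; rewrite addrAC subrr add0r.
rewrite BS LV card_prod !card_ord poweR_EFin -!EFinM lee_fin in L.
rewrite -(ler_pM2l n12); apply: le_trans L.
have q0 : 0 <= 2^-1 ^+ (n1 + n2).+1 :> R by rewrite exprn_ge0 ?invr_ge0.
rewrite powRD; last by rewrite (gt_eqF rho0) implybT.
rewrite !powR_mulrn ?(ltW rho0)// /lam /kap (powRM _ (ltW mu0) q0).
rewrite (exprMn _ rho) le_eqVlt; apply/orP; left; apply/eqP.
move: (rho ^+ N) (rho ^+ 2) ((2 * e) ^+ N) (mu `^ p) ((_ ^+ _) `^ p) => a1 a2 b c d.
by move: (_%:R) n12 => n n_gt0; field; rewrite gt_eqF.
Qed.

End interpolation.

Theorem lemma1 (R : realType) (N : nat) (p T l : R) (Om : set 'rV[R]_N)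
    (N_ge1 : (1 <= N)%N) (p_gt1 : 1 < p) (T_gt0 : 0 < T)
    (l_gt0 : 0 < l) (l_nonint : l \isn't a Num.int)
    (Om_domain : is_domain Om) (Om_smooth : Cl_boundary l Om) :
  exists C : R, 0 < C /\
    forall u : 'rV[R]_N * R -> R,
      holder_space Om T l u -> Lp_space_cyl p Om T u ->
      (let omega := (N%:R + 2) / (l * p + N%:R + 2) in
       (max_norm Om T u <=
          C%:E * holder_norm Om T l u `^ omega
               * Lp_norm_cyl p Om T u `^ (1 - omega)%R)%E) /\
      ((sup_Lp_norm p Om T u < +oo)%E ->
       let sigma := N%:R / (l * p + N%:R) in
       (max_norm Om T u <=
          C%:E * holder_norm Om T l u `^ sigma
               * sup_Lp_norm p Om T u `^ (1 - sigma)%R)%E).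
Proof.
have [oOm _ Om0] := Om_domain.
have p_gt0 : 0 < p := lt_trans ltr01 p_gt1.
have [e e_gt0 cone] := uniform_has_cone oOm Om_smooth.
have [C1 [C10 H1]] := pointwise_interpolation_spacetime N_ge1 T_gt0 l_gt0 p_gt0
  e_gt0 oOm Om0 cone.
have [C2 [C20 H2]] := pointwise_interpolation_space N_ge1 T_gt0 l_gt0 p_gt0
  e_gt0 oOm Om0 cone.
have C12 : C1 <= C1 + C2 by rewrite lerDl ltW.
have C21 : C2 <= C1 + C2 by rewrite lerDr ltW.
exists (C1 + C2); split; first exact: addr_gt0.
move=> u hu Lu; have uc : {within ccyl Om T, continuous u} by case: hu.
have hK := holder_norm_fin N_ge1 T_gt0 oOm Om0 hu.
split=> [|Voo]; lazy zeta.
  (* Membership in L_p makes the norm finite, so the extended powers become real ones. *)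
  have [V LV] : exists V, Lp_norm_cyl p Om T u = V%:E.
    exists (fine (Lp_norm_cyl p Om T u)); rewrite fineK// ge0_fin_numE ?Lnorm_ge0//.
    by have /sub_Lfun_finLfun := Lu; rewrite inE.
  have V0 : 0 <= V by rewrite -lee_fin -LV Lnorm_ge0.
  rewrite hK LV !poweR_EFin -!EFinM; apply: max_norm_le => // -[x t] [/= Ox].
  rewrite in_itv/= => tT.
  have := H1 u hu Lu x t V Ox tT V0 LV; rewrite (addrA (l * p)) => /le_trans; apply.
  by rewrite !ler_wpM2r ?powR_ge0.
set S := sup_Lp_norm p Om T u in Voo *.
(* The supremum over time serves as the common bound for all slices. *)
have LS t : 0 < t < T -> (Lp_norm p Om (fun y => u (y, t)) <= S)%E.
  by move=> tT; apply: ereal_sup_ubound; exists t => //=; rewrite in_itv.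
have S0 : (0 <= S)%E.
  apply: le_trans (LS (T / 2) _); first exact: Lnorm_ge0.
  by apply/andP; split; lra.
have SE : S = (fine S)%:E by rewrite fineK// ge0_fin_numE.
rewrite hK SE !poweR_EFin -!EFinM; apply: max_norm_le => // -[x t] [/= Ox].
rewrite in_itv/= => tT.
have V0 : 0 <= fine S by rewrite fine_ge0.
have := H2 u hu Lu x t (fine S) Ox tT V0; rewrite -SE => /(_ (LS t tT))/le_trans.
by apply; rewrite !ler_wpM2r ?powR_ge0.
Qed.
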